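(* (a) There is an isometry $\beta:\mathbb{P}_+(F^{\mathbb{C}})\to\mathcal{H}^2$ such that $\beta(\bar\rho)=i$, $\beta(w_{\mathcal{P}})=p$, $\beta(w_{\mathcal{L}})=-p^{-1}$ and $\beta(z_0)=0$ (where $\beta$ is extended to the boundary point $[z_0]$). (b) The isometry $\beta$ induces a group homomorphism $c_\beta:\Gamma_F\to\operatorname{PSL}_2(\mathbb{R})$ given by $c_\beta(h)=\beta\circ h\circ\beta^{-1}$. The image of $c_\beta$ contains the principal congruence subgroup $\Gamma(13)\subseteq\operatorname{PSL}_2(\mathbb{Z})$. In fact $$c_\beta(\Gamma_F)\cap\operatorname{PSL}_2(\mathbb{Z})=\nu^{-1}\,\Gamma_0(13)\,\nu,\qquad \nu=\begin{pmatrix}0&1\\-1&5\end{pmatrix}.$$ Further, $c_\beta(\sigma)=S=\begin{pmatrix}0&-1\\1&0\end{pmatrix}$, where $\sigma$ is the involution corresponding to interchanging the points and lines of $\mathbb{P}^2(\mathbb{F}_3)$.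
   Context: Constants: $\omega=e^{2\pi i/3}$, $\mathcal{E}=\mathbb{Z}[\omega]$, $\xi=e^{-\pi i/6}$, $p=2+\omega$, $\theta=\omega-\bar\omega$. Hermitian forms are linear in the second variable. The lattice $L$: let $\mathcal{P}$ and $\mathcal{L}$ be the sets of $13$ points and $13$ lines of $\mathbb{P}^2(\mathbb{F}_3)$. Let $L^\circ$ be the free $\mathcal{E}$-module with basis $\mathcal{P}\cup\mathcal{L}$ and Hermitian form given by $\langle x,x\rangle=\langle l,l\rangle=-3$, $\langle x,x'\rangle=\langle l,l'\rangle=0$ for distinct points $x\ne x'$ and distinct lines $l\neq l'$, and $\langle x,l\rangle=p$ if $x\in l$, $\langle x,l\rangle=0$ otherwise. Let $L=L^\circ/\operatorname{Rad}(L^\circ)$; it is a nondegenerate Hermitian $\mathcal{E}$-lattice of rank $14$ and signature $(1,13)$. The images of the basis vectors in $L$ are denoted by the same symbols. $\operatorname{Aut}(L)$ is the group of $\mathcal{E}$-linear isometries of $L$ and $\mathbb{P}\operatorname{Aut}(L)$ is its quotient by scalars. The sublattice $F$: in $L$ put $w_{\mathcal{P}}=\bar p\,l+\sum_{x'\in l}x'$ and $w_{\mathcal{L}}=p\,x+\sum_{l'\ni x}l'$, which do not depend on the choice of $l\in\mathcal{L}$, $x\in\mathcal{P}$. One has $\langle w_{\mathcal{P}},w_{\mathcal{P}}\rangle=\langle w_{\mathcal{L}},w_{\mathcal{L}}\rangle=3$ and $\langle w_{\mathcal{P}},w_{\mathcal{L}}\rangle=4p$. $F=\mathcal{E}w_{\mathcal{P}}\oplus\mathcal{E}w_{\mathcal{L}}$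 is the rank two primitive sublattice of $L$ fixed pointwise by $\operatorname{PGL}(3,\mathbb{F}_3)$, which acts on $L$ by permuting points and lines. $F^{\mathbb{C}}=F\otimes_{\mathcal{E}}\mathbb{C}$. Put $z_0=w_{\mathcal{P}}+\theta w_{\mathcal{L}}$ (a vector of norm $0$, so $[z_0]$ is a boundary point of $\mathbb{P}_+(F^{\mathbb{C}})$) and $\bar\rho=(w_{\mathcal{P}}+\xi w_{\mathcal{L}})/(2(4+\sqrt3))\in F^{\mathbb{C}}$. $\Gamma_F=\{g\in\mathbb{P}\operatorname{Aut}(L): g(F)=F\}$. The automorphism $\sigma$ is the automorphism of $L$ (restricted to $F$, and considered modulo scalars) given by $\sigma(l)=x_l$, $\sigma(x)=-\omega l_x$, where $x\mapsto l_x$, $l\mapsto x_l$ are mutually inverse bijections $\mathcal{P}\leftrightarrow\mathcal{L}$ preserving incidence (a polarity of $\mathbb{P}^2(\mathbb{F}_3)$). Metrics: $\mathbb{P}_+(F^{\mathbb{C}})$ is the set of complex lines of positive norm in $F^{\mathbb{C}}$, with metric $d([x],[y])=\cosh^{-1}\bigl(|\langle x,y\rangle|/(|x||y|)\bigr)$. $\mathcal{H}^2$ is the upper half plane with $d(\tau,\tau')=\cosh^{-1}\bigl(\tfrac12\operatorname{Im}(\tau)^{-1/2}\operatorname{Im}(\tau')^{-1/2}|\tau'-\bar\tau|\bigr)$. $\Gamma_0(13)$ is the group of integral matrices of determinant $1$ with lower left entry divisible by $13$ (viewed in $\operatorname{PSL}_2(\mathbb{Z})$). *)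

(* Defs.v *)
From HB Require Import structures.
From mathcomp Require Import all_boot all_order all_algebra.
From mathcomp Require Import mxabelem complex ring lra.
From mathcomp Require Import all_classical all_reals all_analysis.

Import Order.TTheory GRing.Theory Num.Theory.

Set Implicit Arguments.
Unset Strict Implicit.
Unset Printing Implicit Defensive.

Local Open Scope classical_set_scope.
Local Open Scope quotient_scope.
Local Open Scope complex_scope.
Local Open Scope ring_scope.


Record normal_sub (G : groupType) := NormalSub {
  ns_set :> G -> Prop;
  ns_1 : ns_set 1%g;
  ns_M : forall x y, ns_set x -> ns_set y -> ns_set (x * y)%g;
  ns_V : forall x, ns_set x -> ns_set (x^-1)%g;
  ns_J : forall x y, ns_set x -> ns_set (x ^ y)%g }.

Section GroupQuotient.
Variables (G : groupType) (N : normal_sub G).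

(* The quotient G / N of a possibly infinite group, as left cosets x N. *)
Definition gq_equiv (x y : G) : bool := `[< N (x^-1 * y)%g >].

Lemma gq_equiv_class : equiv_class_of gq_equiv.
Proof.
have sym x y : gq_equiv x y -> gq_equiv y x.
  by move=> /asboolP /ns_V h; apply/asboolP; move: h; rewrite invgM invgK.
split=> [x | x y | y x z].
- by apply/asboolP; rewrite mulVg; apply: ns_1.
- by apply/idP/idP; apply: sym.
- move=> /asboolP xy /asboolP yz; apply/asboolP.
  by have := ns_M xy yz; rewrite mulgA mulgK.
Qed.

Canonical gq_equivRel := EquivRelPack gq_equiv_class.
Canonical gq_encModRel := defaultEncModRel gq_equiv.

Definition group_quot := {eq_quot gq_equiv}.
HB.instance Definition _ : EqQuotient G gq_equiv group_quot :=
  EqQuotient.on group_quot.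
HB.instance Definition _ := Choice.on group_quot.

Lemma gq_eqP (x y : G) :
  reflect (\pi_group_quot x = \pi_group_quot y) `[< N (x^-1 * y)%g >].
Proof.
apply: (iffP idP) => [h | /eqP]; last by rewrite piE.
by apply/eqP; rewrite piE.
Qed.

Definition gq_one : group_quot := \pi_group_quot 1%g.
Definition gq_mul (x y : group_quot) : group_quot := \pi_group_quot (repr x * repr y)%g.
Definition gq_inv (x : group_quot) : group_quot := \pi_group_quot (repr x)^-1%g.

Lemma gq_repr (x : G) : N (x^-1 * repr (\pi_group_quot x))%g.
Proof. by apply/asboolP/gq_eqP; rewrite reprK. Qed.

Lemma gq_mulE (x y : G) :
  gq_mul (\pi_group_quot x) (\pi_group_quot y) = \pi_group_quot (x * y)%g.
Proof.
apply/esym/gq_eqP/asboolP.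
set x' := repr _; set y' := repr _.
have hx : N (x^-1 * x')%g by apply: gq_repr.
have hy : N (y^-1 * y')%g by apply: gq_repr.
have := ns_M (ns_J y hx) hy.
by rewrite /conjg invgM !mulgA mulgK.
Qed.

Lemma gq_invE (x : G) : gq_inv (\pi_group_quot x) = \pi_group_quot (x^-1)%g.
Proof.
apply/esym/gq_eqP/asboolP; rewrite invgK.
have hx : N (x^-1 * repr (\pi_group_quot x))%g by apply: gq_repr.
have := ns_V (ns_J (x^-1)%g hx).
by rewrite conjgE invgK !mulgA mulgV mul1g invgM invgK.
Qed.

Fact gq_mulA : associative gq_mul.
Proof.
elim/quotW=> x; elim/quotW=> y; elim/quotW=> z.
by rewrite (gq_mulE y z) (gq_mulE x y) !gq_mulE mulgA.
Qed.
Fact gq_mul1 : left_id gq_one gq_mul.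
Proof. by elim/quotW=> x; rewrite gq_mulE mul1g. Qed.
Fact gq_1mul : right_id gq_one gq_mul.
Proof. by elim/quotW=> x; rewrite gq_mulE mulg1. Qed.
Fact gq_mulV : left_inverse gq_one gq_inv gq_mul.
Proof. by elim/quotW=> x; rewrite gq_invE gq_mulE mulVg. Qed.
Fact gq_Vmul : right_inverse gq_one gq_inv gq_mul.
Proof. by elim/quotW=> x; rewrite gq_invE gq_mulE mulgV. Qed.

HB.instance Definition _ :=
  isGroup.Build group_quot gq_mulA gq_mul1 gq_1mul gq_mulV gq_Vmul.

Definition gq_pi (x : G) : group_quot := \pi_group_quot x.

Lemma gq_piM : {morph gq_pi : x y / (x * y)%g}.
Proof. by move=> x y; apply/esym/gq_mulE. Qed.

Lemma gq_pi_eq (x y : G) : gq_pi x = gq_pi y <-> N (x^-1 * y)%g.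
Proof. by split=> [/gq_eqP /asboolP | /asboolP /gq_eqP]. Qed.

End GroupQuotient.

Section SL2.
Variable A : comNzRingType.

Record SL2 := MkSL2 { SL2_mx :> 'M[A]_2; SL2_det : \det SL2_mx == 1 }.
HB.instance Definition _ := [isSub for SL2_mx].
HB.instance Definition _ := [Choice of SL2 by <:].

Fact SL2_one_subproof : \det (1%:M : 'M[A]_2) == 1.
Proof. by rewrite det1. Qed.
Fact SL2_mul_subproof (M N : SL2) : \det ((M : 'M[A]_2) *m N) == 1.
Proof. by rewrite det_mulmx (eqP (SL2_det M)) (eqP (SL2_det N)) mulr1. Qed.
Fact SL2_inv_subproof (M : SL2) : \det (\adj (M : 'M[A]_2)) == 1.
Proof.
have := congr1 determinant (mul_mx_adj (M : 'M[A]_2)).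
by rewrite det_mulmx (eqP (SL2_det M)) det1 mul1r => ->.
Qed.

Definition SL2_one := MkSL2 SL2_one_subproof.
Definition SL2_mul M N := MkSL2 (SL2_mul_subproof M N).
Definition SL2_inv M := MkSL2 (SL2_inv_subproof M).

Fact SL2_mulA : associative SL2_mul.
Proof. by move=> M N P; apply/val_inj/mulmxA. Qed.
Fact SL2_mul1 : left_id SL2_one SL2_mul.
Proof. by move=> M; apply/val_inj/mul1mx. Qed.
Fact SL2_1mul : right_id SL2_one SL2_mul.
Proof. by move=> M; apply/val_inj/mulmx1. Qed.
Fact SL2_mulV : left_inverse SL2_one SL2_inv SL2_mul.
Proof.
by move=> M; apply/val_inj => /=; rewrite mul_adj_mx (eqP (SL2_det M)).
Qed.
Fact SL2_Vmul : right_inverse SL2_one SL2_inv SL2_mul.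
Proof.
by move=> M; apply/val_inj => /=; rewrite mul_mx_adj (eqP (SL2_det M)).
Qed.
HB.instance Definition _ :=
  isGroup.Build SL2 SL2_mulA SL2_mul1 SL2_1mul SL2_mulV SL2_Vmul.

Definition mx2 (a b c d : A) : 'M[A]_2 :=
  \matrix_(i, j) if i == 0 then (if j == 0 then a else b)
                 else (if j == 0 then c else d).

Lemma det_mx2 a b c d : \det (mx2 a b c d) = a * d - b * c.
Proof.
rewrite (expand_det_row _ ord0) !big_ord_recl big_ord0 /cofactor.
by rewrite !det_mx11 !mxE /= expr0 expr1 mulN1r mul1r addr0 mulrN.
Qed.

Definition pm1_set : set SL2 :=
  [set M | M = 1%:M :> 'M[A]_2 \/ M = - 1%:M :> 'M[A]_2].

Lemma SL2_mulE (M N : SL2) : (M * N)%g = (M : 'M[A]_2) *m N :> 'M[A]_2.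
Proof. by []. Qed.
Lemma SL2_mulVE (M : SL2) : ((M^-1)%g : 'M[A]_2) *m M = 1%:M.
Proof. by rewrite -SL2_mulE mulVg. Qed.

Fact pm1_1 : pm1_set 1%g. Proof. by left. Qed.
Fact pm1_M M N : pm1_set M -> pm1_set N -> pm1_set (M * N)%g.
Proof.
rewrite /pm1_set /mkset SL2_mulE => -[->|->] [->|->];
  rewrite ?(mul1mx, mulNmx, opprK); by [left|right].
Qed.
Fact pm1_V M : pm1_set M -> pm1_set M^-1%g.
Proof.
have := SL2_mulVE M; rewrite /pm1_set /mkset => e h.
case: h e => ->; first by rewrite mulmx1 => ->; left.
by rewrite mulmxN mulmx1 => <-; right; rewrite opprK.
Qed.
Fact pm1_J M N : pm1_set M -> pm1_set (M ^ N)%g.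
Proof.
rewrite /pm1_set /mkset conjgE !SL2_mulE => -[->|->].
  by left; rewrite mul1mx SL2_mulVE.
by right; rewrite mulNmx mul1mx mulmxN SL2_mulVE.
Qed.
Definition pm1 : normal_sub SL2 := NormalSub pm1_1 pm1_M pm1_V pm1_J.

Definition PSL2 := group_quot pm1.
HB.instance Definition _ := Group.on PSL2.

Definition PSL2_class (M : SL2) : PSL2 := gq_pi pm1 M.

End SL2.


(* A k-dimensional subspace of F_3^3 is encoded by the canonical matrix <<A>>
   whose row space it is, so that equality of codes is equality of subspaces. *)
Definition subspace3 (k : nat) : Type :=
  {A : 'M['F_3]_3 | (<<A>>%MS == A) && (\rank A == k)}.
HB.instance Definition _ k := Finite.on (subspace3 k).

Definition ppoint := subspace3 1.
Definition pline := subspace3 2.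
HB.instance Definition _ := Finite.on ppoint.
HB.instance Definition _ := Finite.on pline.

Definition incident (x : ppoint) (l : pline) : bool := (val x <= val l)%MS.

Section Plane.
Implicit Types (x y : ppoint) (l m : pline).

Lemma rank_sub3 k (A : subspace3 k) : \rank (val A) = k.
Proof. by case: A => A /= /andP[_ /eqP]. Qed.

Lemma gen_sub3 k (A : subspace3 k) : <<val A>>%MS = val A.
Proof. by case: A => A /= /andP[/eqP]. Qed.

Lemma mk_sub3_subproof k (A : 'M['F_3]_3) :
  \rank A = k -> (<<(<<A>>)>>%MS == <<A>>%MS) && (\rank <<A>>%MS == k).
Proof. by move=> rA; rewrite genmx_id eqxx mxrank_gen rA eqxx. Qed.

Definition mk_sub3 k (A : 'M['F_3]_3) (rA : \rank A = k) : subspace3 k :=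
  Sub <<A>>%MS (mk_sub3_subproof rA).

Lemma sub3_inj k (A B : subspace3 k) : (val A <= val B)%MS -> A = B.
Proof.
move=> AB; apply/val_inj; rewrite -[LHS]gen_sub3 -[RHS]gen_sub3.
apply/genmxP/andP; split=> //.
by rewrite -(geq_leqif (mxrank_leqif_sup AB)) !rank_sub3.
Qed.

Lemma join_rank x y : x != y -> \rank (val x + val y)%MS = 2.
Proof.
move=> xy; have := mxrank_sum_cap (val x) (val y).
rewrite !rank_sub3; set c := \rank (_ :&: _)%MS => e.
suff c0 : c = 0%N by move: e; rewrite c0 addn0.
apply/eqP; apply: contraNT xy; rewrite -lt0n => c1; apply/eqP/sub3_inj.
have := mxrank_leqif_sup (capmxSl (val x) (val y)).
move=> /geq_leqif; rewrite rank_sub3 c1 => /esym.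
by rewrite sub_capmx submx_refl.
Qed.

Lemma unique_line x y : x != y -> #|[set l | incident x l && incident y l]%SET| = 1%N.
Proof.
move=> xy; pose l := mk_sub3 (join_rank xy).
apply/eqP/cards1P; exists l; apply/setP => m; rewrite !inE /incident.
apply/idP/eqP => [|->]; last by rewrite /= !genmxE addsmxSl addsmxSr.
by rewrite -addsmx_sub => h; apply/esym/sub3_inj; rewrite /= genmxE.
Qed.

Lemma card_points_on l : #|[set x | incident x l]%SET| = 4%N.
Proof.
have F3 : #|'F_3| = 3%N by rewrite card_Fp.
pose V (A : 'M['F_3]_3) : {set 'rV['F_3]_3} := ([set v | (v != 0) && (v <= A)%MS])%SET.
have cV A : #|V A|.+1 = (3 ^ \rank A)%N.
  have := card_rowg A; rewrite F3 => <-.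
  rewrite [#|rowg A|](cardsD1 0) inE sub0mx add1n; congr _.+1.
  by apply: eq_card => v; rewrite !inE.
have r1 (v : 'rV['F_3]_3) : v != 0 -> \rank <<v>>%MS = 1%N.
  by rewrite mxrank_gen rank_rV => ->.
have x0 : ppoint.
  have h : \rank (<<delta_mx 0 0 : 'rV['F_3]_3>>%MS) = 1%N.
    rewrite r1 //; apply/eqP => /matrixP /(_ 0 0).
    by rewrite !mxE.
  exact: mk_sub3 h.
pose pt v : ppoint := insubd x0 (<<v : 'rV['F_3]_3>>%MS).
have ptE v x : v != 0 -> (pt v == x) = (v <= val x)%MS.
  move=> v0.
  have vpt : val (pt v) = <<v>>%MS.
    by rewrite /pt val_insubd genmx_id eqxx r1.
  apply/eqP/idP => [<- | h]; first by rewrite vpt genmxE.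
  by apply: sub3_inj; rewrite vpt genmxE.
have : #|V (val l)| = (\sum_(x in [set x | incident x l]%SET) 2)%N.
  rewrite -sum1_card (partition_big pt (mem [set x | incident x l]%SET)) /=.
    apply: eq_bigr => x; rewrite inE /incident => xl.
    have := cV (val x); rewrite rank_sub3 => -[V2].
    transitivity #|V (val x)|; last exact: V2.
    rewrite sum1dep_card; apply: eq_card => v; rewrite !inE.
    case: (eqVneq v 0) => //= v0; rewrite ptE // andbC.
    by case: (boolP (v <= val x)%MS) => //= /submx_trans ->.
  move=> v; rewrite !inE /incident => /andP[v0 vl].
  by rewrite /pt val_insubd genmx_id eqxx r1 //= genmxE.
rewrite sum_nat_const; have := cV (val l); rewrite rank_sub3 => -[->] e.
by apply/eqP; rewrite -(eqn_pmul2r (isT : 0 < 2)%N) -e.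
Qed.

Lemma perp_rank k (A : subspace3 k) : \rank (kermx (val A)^T) = (3 - k)%N.
Proof. by rewrite mxrank_ker mxrank_tr rank_sub3. Qed.

Definition perp_point x : pline := mk_sub3 (perp_rank x).
Definition perp_line l : ppoint := mk_sub3 (perp_rank l).

Lemma perp_sub (A B : 'M['F_3]_3) : (A <= kermx B^T)%MS = (B <= kermx A^T)%MS.
Proof.
by rewrite !sub_kermx -[RHS]trmx_eq0 trmx_mul trmxK.
Qed.

Definition is_polarity (lx : ppoint -> pline) (xl : pline -> ppoint) : Prop :=
  [/\ cancel lx xl, cancel xl lx &
      forall x l, incident x l = incident (xl l) (lx x)].

Lemma perp_polarity : is_polarity perp_point perp_line.
Proof.
have K1 : cancel perp_point perp_line.
  move=> x; apply/esym/sub3_inj; rewrite /= genmxE perp_sub.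
  by rewrite genmxE.
have K2 : cancel perp_line perp_point.
  move=> l; apply/esym/sub3_inj; rewrite /= genmxE perp_sub.
  by rewrite genmxE.
split=> // x l; rewrite /incident -[in LHS](K2 l) /= !genmxE.
by rewrite perp_sub genmxE.
Qed.

Lemma card_lines_through x : #|[set l | incident x l]%SET| = 4%N.
Proof.
have [K1 K2 K] := perp_polarity.
rewrite -(card_points_on (perp_point x)) -(card_imset _ (can_inj K1)).
apply: eq_card => l; rewrite inE; apply/idP/imsetP => [h | [y]].
  by exists (perp_line l); rewrite ?K2 // inE -K.
by rewrite inE => h ->; rewrite K K1.
Qed.

Lemma unique_point l m :
  l != m -> #|[set x | incident x l && incident x m]%SET| = 1%N.
Proof.
have [K1 K2 K] := perp_polarity.
rewrite -(can_eq K2) => /unique_line <-; rewrite -(card_imset _ (can_inj K2)).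
apply: eq_card => x; rewrite inE; apply/idP/imsetP => [h | [k]].
  by exists (perp_point x); rewrite ?K1 // inE -!K.
by rewrite inE => h ->; rewrite (K _ l) (K _ m) K2.
Qed.

Lemma rank_line0 : \rank (pid_mx 2 : 'M['F_3]_3) = 2%N.
Proof. by rewrite rank_pid_mx. Qed.
Lemma rank_point0 : \rank (pid_mx 1 : 'M['F_3]_3) = 1%N.
Proof. by rewrite rank_pid_mx. Qed.
Definition line0 : pline := mk_sub3 rank_line0.
Definition point0 : ppoint := mk_sub3 rank_point0.

End Plane.

Section Constants.
Variable R : realType.

Definition cis (t : R) : R[i] := cos t +i* sin t.

Definition omega : R[i] := cis (2 * pi / 3).
Definition xi : R[i] := cis (- (pi / 6)).
(* the constant p *)
Definition pC : R[i] := 2 + omega.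
Definition theta : R[i] := omega - conjc omega.

(* Z[omega], as the values at omega of integral polynomials *)
Definition eisenstein_set : {pred R[i]} :=
  fun z => `[< exists q : {poly int}, z = (map_poly intr q).[omega] >].

Fact eisenstein_subring : subring_closed eisenstein_set.
Proof.
split=> [|_ _ /asboolP[q ->] /asboolP[r ->]|_ _ /asboolP[q ->] /asboolP[r ->]];
  apply/asboolP.
- by exists 1; rewrite rmorph1 hornerE.
- by exists (q - r); rewrite rmorphB !hornerE.
- by exists (q * r); rewrite rmorphM !hornerE.
Qed.
HB.instance Definition _ :=
  GRing.isSubringClosed.Build R[i] eisenstein_set eisenstein_subring.

Record eisenstein :=
  Eisenstein { eis_val :> R[i]; eisP : eis_val \in eisenstein_set }.
HB.instance Definition _ := [isSub for eis_val].
HB.instance Definition _ := [Choice of eisenstein by <:].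
HB.instance Definition _ := [SubChoice_isSubComNzRing of eisenstein by <:].

Lemma omega_eis : omega \in eisenstein_set.
Proof. by apply/asboolP; exists 'X; rewrite map_polyX hornerX. Qed.

Definition omegaE : eisenstein := Eisenstein omega_eis.

End Constants.

Section Lattice.
Variable R : realType.
Local Notation E := (eisenstein R).
Local Notation C := (R[i]).

Definition vertex : Type := (ppoint + pline)%type.
HB.instance Definition _ := Finite.on vertex.

Definition gram (u v : vertex) : C :=
  match u, v with
  | inl x, inl y => if x == y then -3 else 0
  | inr l, inr m => if l == m then -3 else 0
  | inl x, inr l => if incident x l then pC R else 0
  | inr l, inl x => if incident x l then conjc (pC R) else 0
  end.

Lemma gram_conj u v : conjc (gram u v) = gram v u.
Proof.
rewrite /gram; case: u v => [x|l] [y|m];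
  rewrite 1?[y == _]eq_sym 1?[m == _]eq_sym;
  by case: ifP => _; rewrite ?conjc0 ?conjcK // rmorphN rmorph_nat.
Qed.

(* preL is the free module L° and latL its quotient L = L°/Rad(L°). *)
Definition preL : Type := {ffun vertex -> E^o}.
HB.instance Definition _ := GRing.Lmodule.on preL.

Definition preL_basis (v : vertex) : preL := [ffun w => (w == v)%:R].

(* conjugate-linear in the first variable, linear in the second *)
Definition preform (u v : preL) : C :=
  \sum_i \sum_j conjc (eis_val (u i)) * gram i j * eis_val (v j).

Definition radical : {pred preL} := fun u => `[< forall v, preform u v = 0 >].

Lemma preformDZr a u v w :
  preform u (a *: v + w) = eis_val a * preform u v + preform u w.
Proof.
rewrite /preform mulr_sumr -big_split; apply: eq_bigr => i _ /=.
rewrite mulr_sumr -big_split; apply: eq_bigr => j _ /=.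
rewrite !ffunE /= mulrDr; congr (_ + _).
by rewrite [RHS]mulrCA.
Qed.

Lemma preform_conj u v : conjc (preform u v) = preform v u.
Proof.
rewrite /preform rmorph_sum exchange_big; apply: eq_bigr => i _ /=.
rewrite rmorph_sum; apply: eq_bigr => j _ /=.
by rewrite !rmorphM /= conjcK gram_conj mulrC mulrA mulrAC.
Qed.

Lemma preform_radr u v : v \in radical -> preform u v = 0.
Proof. by move=> /asboolP h; rewrite -preform_conj h rmorph0. Qed.

Fact radical_submod : submod_closed radical.
Proof.
split=> [|a u v hu hv]; apply/asboolP => w.
  by rewrite -preform_conj -[0](addNr 0) -scaleN1r preformDZr !mulN1r addNr conjc0.
rewrite -preform_conj preformDZr.
by rewrite (preform_radr w hu) (preform_radr w hv) mulr0 addr0 rmorph0.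
Qed.
HB.instance Definition _ :=
  GRing.isSubmodClosed.Build E preL radical radical_submod.

Definition latL : Type := Quotient.quot radical.
HB.instance Definition _ := GRing.Zmodule.on latL.
HB.instance Definition _ := EqQuotient.on latL.

Definition toL (u : preL) : latL := \pi_latL u.

Lemma toL_eqP u v : reflect (toL u = toL v) (u - v \in radical).
Proof. by rewrite Quotient.idealrBE; apply: eqP. Qed.

Lemma toLD u v : toL (u + v) = toL u + toL v.
Proof. by rewrite /toL !piE. Qed.

Lemma toL_repr u : toL (repr u) = u.
Proof. exact: reprK. Qed.

Definition latL_scale (a : E) (u : latL) : latL := toL (a *: repr u).

Lemma latL_scaleE a u : latL_scale a (toL u) = toL (a *: u).
Proof.
apply/toL_eqP; rewrite -scalerBr rpredZ //.
by apply/toL_eqP; rewrite toL_repr.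
Qed.

Lemma toL_ind (P : latL -> Prop) : (forall u, P (toL u)) -> forall u, P u.
Proof. by move=> h u; rewrite -[u]toL_repr. Qed.

Fact latL_scaleA a b u : latL_scale a (latL_scale b u) = latL_scale (a * b) u.
Proof. by elim/toL_ind: u => u; rewrite !latL_scaleE scalerA. Qed.
Fact latL_scale1 : left_id 1 latL_scale.
Proof. by elim/toL_ind=> u; rewrite latL_scaleE scale1r. Qed.
Fact latL_scaleDr : right_distributive latL_scale +%R.
Proof.
move=> a; elim/toL_ind=> u; elim/toL_ind=> v.
by rewrite -toLD !latL_scaleE scalerDr toLD.
Qed.
Fact latL_scaleDl u : {morph latL_scale^~ u : a b / a + b}.
Proof.
by move=> a b; elim/toL_ind: u => u; rewrite !latL_scaleE scalerDl toLD.
Qed.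
HB.instance Definition _ := GRing.Zmodule_isLmodule.Build E latL
  latL_scaleA latL_scale1 latL_scaleDr latL_scaleDl.

Lemma toL_linear : linear toL.
Proof. by move=> a u v; rewrite toLD -latL_scaleE. Qed.
HB.instance Definition _ := GRing.isLinear.Build E preL latL _ toL toL_linear.

End Lattice.

HB.lock Definition hform (R : realType) (u v : latL R) : R[i] :=
  preform (repr u) (repr v).

Section LatticeForm.
Variable R : realType.
Implicit Types u v : preL R.

Lemma formE u v : hform (toL u) (toL v) = preform u v.
Proof.
have eqr (a b w : preL R) : toL a = toL b -> preform w a = preform w b.
  move=> /toL_eqP /(preform_radr w) h.
  by rewrite -[a in LHS](subrK b) -[_ - b]scale1r preformDZr h mulr0 add0r.
have eql (a b w : preL R) : toL a = toL b -> preform a w = preform b w.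
  by move=> /(eqr _ _ w) h; rewrite -[LHS]preform_conj h preform_conj.
by rewrite hform.unlock (eqr _ v) ?toL_repr // (eql _ u) ?toL_repr.
Qed.


Lemma preL_basisE i j : eis_val (preL_basis R i j) = (j == i)%:R.
Proof. by rewrite ffunE; case: (j == i). Qed.

Lemma preform_basis i j : preform (preL_basis R i) (preL_basis R j) = gram R i j.
Proof.
rewrite /preform (bigD1 i) //= (bigD1 j) //= !preL_basisE !eqxx.
rewrite conjc1 mul1r mulr1 !big1 ?addr0 // => k kj.
  rewrite big1 // => m _.
  by rewrite preL_basisE (negPf kj) conjc0 !mul0r.
by rewrite !preL_basisE (negPf kj) mulr0.
Qed.

End LatticeForm.

HB.lock Definition vpt (R : realType) (x : ppoint) : latL R :=
  toL (preL_basis R (inl x)).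
HB.lock Definition vln (R : realType) (l : pline) : latL R :=
  toL (preL_basis R (inr l)).

Section Omega.
Variable R : realType.

Lemma cos_2pi3 : cos (2 * pi / 3 : R) = - 2^-1.
Proof.
set t : R := 2 * pi / 3; have tE : t + t = pi *+ 2 - t.
  by rewrite /t -mulr_natr; field.
have s0 : 0 < sin t.
  apply: sin_gt0_pi; have := @pi_gt0 R; rewrite /t => pi0.
  by apply/andP; split; lra.
have ct : cos (t + t) = cos t.
  by rewrite tE addrC cosD2pi cosN.
have cs := cos2Dsin2 t.
move: ct; rewrite cosD => ct.
have h : (cos t - 1) * (2 * cos t + 1) = 0 by nra.
have c1 : cos t - 1 != 0.
  apply/eqP => h1; have c1 : cos t = 1 by lra.
  by have := mulr_gt0 s0 s0; rewrite c1 in cs; lra.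
move/eqP: h; rewrite mulf_eq0 (negPf c1) /= => /eqP; lra.
Qed.

Lemma omegaJ : conjc (omega R) = omega R ^+ 2.
Proof.
have c := cos_2pi3; have cs := cos2Dsin2 (2 * pi / 3 : R).
rewrite expr2 /omega /cis; set a := cos _ in c cs *; set b := sin _ in cs *.
by apply/eqP; rewrite eq_complex /=; apply/andP; split; apply/eqP; nra.
Qed.

Lemma pJ_def : conjc (pC R) = 2 + omega R ^+ 2.
Proof. by rewrite /pC rmorphD rmorph_nat; congr (_ + _); apply: omegaJ. Qed.

Lemma p_norm : pC R * conjc (pC R) = 3.
Proof.
have c := cos_2pi3; have cs := cos2Dsin2 (2 * pi / 3 : R).
rewrite /pC /omega /cis; set a := cos _ in c cs *; set b := sin _ in cs *.
by apply/eqP; rewrite eq_complex /=; apply/andP; split; apply/eqP; nra.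
Qed.

Definition pE : eisenstein R := 2 + omegaE R.
Definition pbarE : eisenstein R := 2 + omegaE R ^+ 2.

Lemma pE_val : eis_val pE = pC R. Proof. by []. Qed.
Lemma pbarE_val : eis_val pbarE = conjc (pC R).
Proof. by rewrite pJ_def. Qed.

Lemma eis_conj (a : eisenstein R) : conjc (eis_val a) \in @eisenstein_set R.
Proof.
case: a => _ /= /asboolP[q ->]; apply/asboolP; exists (q \Po 'X^2).
rewrite map_comp_poly map_polyXn horner_comp hornerXn -omegaJ -horner_map /=.
congr (_.[_]); rewrite -map_poly_comp; apply: eq_map_poly => m /=.
exact: rmorph_int.
Qed.

End Omega.

Section Fixed.
Variable R : realType.
Local Notation E := (eisenstein R).
Local Notation L := (latL R).

Lemma formDZr a (u v w : L) :
  hform u (a *: v + w) = eis_val a * hform u v + hform u w.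
Proof.
elim/toL_ind: u => u; elim/toL_ind: v => v; elim/toL_ind: w => w.
by rewrite -linearP !formE preformDZr.
Qed.

Lemma form_conj (u v : L) : conjc (hform u v) = hform v u.
Proof. by rewrite hform.unlock preform_conj. Qed.

Lemma form0r (u : L) : hform u 0 = 0.
Proof.
by rewrite -[0 in LHS](addNr 0) -scaleN1r formDZr mulN1r addNr.
Qed.
Lemma formDr (u v w : L) : hform u (v + w) = hform u v + hform u w.
Proof. by rewrite -[v]scale1r formDZr mul1r scale1r. Qed.
Lemma formZr a (u v : L) : hform u (a *: v) = eis_val a * hform u v.
Proof. by rewrite -[a *: v]addr0 formDZr form0r addr0. Qed.
Lemma form_sumr (I : Type) (r : seq I) (P : pred I) (f : I -> L) u :
  hform u (\sum_(i <- r | P i) f i) = \sum_(i <- r | P i) hform u (f i).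
Proof. by apply: (big_morph (hform u) (formDr u) (form0r u)). Qed.

Lemma preL_sum (u : {ffun vertex -> E^o}) :
  u = \sum_v u v *: (preL_basis R v : {ffun vertex -> E^o}).
Proof.
apply/ffunP => w; rewrite sum_ffunE.
rewrite (eq_bigr (fun v => u v * (w == v)%:R)) => [|v _]; last by rewrite !ffunE.
rewrite (bigD1 w) // eqxx [u w * _]mulr1 big1 => [|v vw].
  by rewrite [RHS]addr0.
by rewrite eq_sym (negPf vw) [LHS]mulr0.
Qed.

Lemma form_pt_pt x y : hform (vpt R x) (vpt R y) = if x == y then -3 else 0.
Proof. by rewrite ?(vpt.unlock, vln.unlock) [LHS]formE preform_basis. Qed.
Lemma form_ln_ln l m : hform (vln R l) (vln R m) = if l == m then -3 else 0.
Proof. by rewrite ?(vpt.unlock, vln.unlock) [LHS]formE preform_basis. Qed.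
Lemma form_pt_ln x l : hform (vpt R x) (vln R l) = if incident x l then pC R else 0.
Proof. by rewrite ?(vpt.unlock, vln.unlock) [LHS]formE preform_basis. Qed.
Lemma form_ln_pt l x :
  hform (vln R l) (vpt R x) = if incident x l then conjc (pC R) else 0.
Proof. by rewrite ?(vpt.unlock, vln.unlock) [LHS]formE preform_basis. Qed.

Lemma form_eq (u v : L) :
  (forall x, hform (vpt R x) u = hform (vpt R x) v) ->
  (forall l, hform (vln R l) u = hform (vln R l) v) -> u = v.
Proof.
move=> hP hL.
suff h w : hform w (-1 *: v + u) = 0.
  elim/toL_ind: u {hP hL} h => u; elim/toL_ind: v => v h.
  apply/toL_eqP/asboolP => w; have := h (toL w).
  rewrite -linearP formE scaleN1r addrC => e.
  by rewrite -preform_conj e conjc0.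
have wE (w' : preL R) : toL w' = \sum_v w' v *: toL (preL_basis R v).
  rewrite {1}[w']preL_sum linear_sum; apply: eq_bigr => k _.
  by rewrite linearZ.
elim/toL_ind: w => w; rewrite -form_conj wE form_sumr.
rewrite vpt.unlock in hP; rewrite vln.unlock in hL.
rewrite big1 ?conjc0 // => -[x|l] _; rewrite formZr -form_conj formDZr.
  by rewrite hP mulN1r addNr conjc0 mulr0.
by rewrite hL mulN1r addNr conjc0 mulr0.
Qed.

Definition wP_at (l : pline) : L :=
  pbarE R *: vln R l + \sum_(x | incident x l) vpt R x.
Definition wL_at (x : ppoint) : L :=
  pE R *: vpt R x + \sum_(l | incident x l) vln R l.

Lemma form_wP_at u l : hform u (wP_at l) =
  conjc (pC R) * hform u (vln R l) + \sum_(x | incident x l) hform u (vpt R x).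
Proof. by rewrite /wP_at formDZr pbarE_val; congr (_ + _); apply: form_sumr. Qed.
Lemma form_wL_at u x : hform u (wL_at x) =
  pC R * hform u (vpt R x) + \sum_(l | incident x l) hform u (vln R l).
Proof. by rewrite /wL_at formDZr pE_val; congr (_ + _); apply: form_sumr. Qed.

Lemma form_pt_wP x l : hform (vpt R x) (wP_at l) = 0.
Proof.
rewrite (form_wP_at (vpt R x) l) (form_pt_ln x l).
under eq_bigr => y _ do rewrite (form_pt_pt x y).
rewrite -big_mkcondr /=; case: ifPn => xl.
  rewrite (big_pred1 x) => [|y]; first by rewrite mulrC p_norm subrr.
  by rewrite /= eq_sym; case: eqVneq => [->|] //; rewrite ?xl ?andbF.
rewrite mulr0 add0r big_pred0 // => y.
by case: (eqVneq x y) => [<-|]; rewrite ?(negPf xl) ?andbF.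
Qed.

Lemma form_ln_wP m l : hform (vln R m) (wP_at l) = conjc (pC R).
Proof.
rewrite (form_wP_at (vln R m) l) (form_ln_ln m l).
under eq_bigr => y _ do rewrite (form_ln_pt m y).
rewrite -big_mkcondr /= sumr_const.
case: (eqVneq m l) => [->|ml].
  have -> : #|[pred y | incident y l && incident y l]| = 4%N.
    by rewrite -(card_points_on l); apply: eq_card => y; rewrite !inE andbb.
  by rewrite -[X in _ + X]mulr_natr -mulrDr [X in _ * X](_ : _ = 1) ?mulr1 //; ring.
have -> : #|[pred y | incident y l && incident y m]| = 1%N.
  by rewrite eq_sym in ml; rewrite -(unique_point ml); apply: eq_card => y; rewrite !inE.
by rewrite mulr0 add0r.
Qed.

Lemma form_ln_wL m x : hform (vln R m) (wL_at x) = 0.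
Proof.
rewrite (form_wL_at (vln R m) x) (form_ln_pt m x).
under eq_bigr => y _ do rewrite (form_ln_ln m y).
rewrite -big_mkcondr /=; case: ifPn => xm.
  rewrite (big_pred1 m) => [|y]; first by rewrite p_norm subrr.
  by rewrite /= eq_sym; case: eqVneq => [->|] //; rewrite ?xm ?andbF.
rewrite mulr0 add0r big_pred0 // => y.
by case: (eqVneq m y) => [<-|]; rewrite ?(negPf xm) ?andbF.
Qed.

Lemma form_pt_wL y x : hform (vpt R y) (wL_at x) = pC R.
Proof.
rewrite (form_wL_at (vpt R y) x) (form_pt_pt y x).
under eq_bigr => l _ do rewrite (form_pt_ln y l).
rewrite -big_mkcondr /= sumr_const.
case: (eqVneq y x) => [->|yx].
  have -> : #|[pred l | incident x l && incident x l]| = 4%N.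
    by rewrite -(card_lines_through x); apply: eq_card => l; rewrite !inE andbb.
  by rewrite -[X in _ + X]mulr_natr -mulrDr [X in _ * X](_ : _ = 1) ?mulr1 //; ring.
have -> : #|[pred l | incident x l && incident y l]| = 1%N.
  by rewrite eq_sym in yx; rewrite -(unique_line yx); apply: eq_card => l; rewrite !inE.
by rewrite mulr0 add0r.
Qed.

Lemma wP_at_indep l m : wP_at l = wP_at m.
Proof.
by apply: form_eq => [x|k]; rewrite ?form_pt_wP ?form_ln_wP.
Qed.
Lemma wL_at_indep x y : wL_at x = wL_at y.
Proof.
by apply: form_eq => [z|k]; rewrite ?form_pt_wL ?form_ln_wL.
Qed.

Lemma form_wP_at_wP_at l m : hform (wP_at l) (wP_at m) = 3.
Proof.
rewrite (form_wP_at (wP_at l) m) -[hform _ (vln R m)]form_conj (form_ln_wP m l).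
rewrite conjcK big1 ?addr0; first by rewrite mulrC p_norm.
by move=> x _; rewrite -[LHS]form_conj (form_pt_wP x l) conjc0.
Qed.

Lemma form_wL_at_wL_at x y : hform (wL_at x) (wL_at y) = 3.
Proof.
rewrite (form_wL_at (wL_at x) y) -[hform _ (vpt R y)]form_conj (form_pt_wL y x).
rewrite big1 ?addr0; first by rewrite p_norm.
by move=> l _; rewrite -[LHS]form_conj (form_ln_wL l x) conjc0.
Qed.

Lemma form_wP_at_wL_at l x : hform (wP_at l) (wL_at x) = 4 * pC R.
Proof.
rewrite (form_wL_at (wP_at l) x) -[hform _ (vpt R x)]form_conj (form_pt_wP x l).
rewrite conjc0 mulr0 add0r.
under eq_bigr => m _ do
  rewrite -[hform (wP_at l) (vln R m)]form_conj (form_ln_wP m l) conjcK.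
rewrite sumr_const [X in _ *+ X](_ : _ = 4%N) ?mulr_natl //.
by rewrite -(card_lines_through x); apply: eq_card => m; rewrite inE.
Qed.

End Fixed.

(* The choices of line and point are immaterial by wP_at_indep and
   wL_at_indep. *)
HB.lock Definition wP (R : realType) : latL R := wP_at R line0.
HB.lock Definition wL (R : realType) : latL R := wL_at R point0.

Section Gram.
Variable R : realType.

Lemma form_wP_wP : hform (wP R) (wP R) = 3.
Proof. by rewrite wP.unlock form_wP_at_wP_at. Qed.
Lemma form_wL_wL : hform (wL R) (wL R) = 3.
Proof. by rewrite wL.unlock form_wL_at_wL_at. Qed.
Lemma form_wP_wL : hform (wP R) (wL R) = 4 * pC R.
Proof. by rewrite wP.unlock wL.unlock form_wP_at_wL_at. Qed.

End Gram.

Record autL (R : realType) := AutL {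
  aut_fun :> latL R -> latL R;
  aut_linear : linear aut_fun;
  aut_bij : bijective aut_fun;
  aut_form : forall u v, hform (aut_fun u) (aut_fun v) = hform u v }.

HB.instance Definition _ R := gen_eqMixin (autL R).
HB.instance Definition _ R := gen_choiceMixin (autL R).

Section Automorphisms.
Variable R : realType.
Local Notation E := (eisenstein R).
Local Notation L := (latL R).

Lemma autL_eq (g h : autL R) : aut_fun g =1 aut_fun h -> g = h.
Proof.
case: g h => [g g1 g2 g3] [h h1 h2 h3] /= /funext e.
by move: g1 g2 g3; rewrite e => *; congr AutL; apply: Prop_irrelevance.
Qed.

Definition autL_one : autL R.
Proof. by exists id => //; exists id. Defined.

Definition autL_mul (g h : autL R) : autL R.
Proof.
exists (aut_fun g \o aut_fun h).
- by move=> a u v /=; rewrite !aut_linear.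
- exact: bij_comp (aut_bij g) (aut_bij h).
- by move=> u v /=; rewrite !aut_form.
Defined.

Lemma autL_inv_ex (g : autL R) :
  exists h : autL R, cancel g h /\ cancel h g.
Proof.
have [h gh hg] := aut_bij g.
have lh : linear h.
  by move=> a u v; apply: (can_inj gh); rewrite aut_linear !hg.
have fh u v : hform (h u) (h v) = hform u v by rewrite -(aut_form g) !hg.
by exists (AutL lh (Bijective hg gh) fh).
Qed.

Definition autL_inv (g : autL R) : autL R := sval (cid (autL_inv_ex g)).

Fact autL_mulA : associative autL_mul.
Proof. by move=> g h k; apply: autL_eq. Qed.
Fact autL_mul1 : left_id autL_one autL_mul.
Proof. by move=> g; apply: autL_eq. Qed.
Fact autL_1mul : right_id autL_one autL_mul.
Proof. by move=> g; apply: autL_eq. Qed.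
Fact autL_mulV : left_inverse autL_one autL_inv autL_mul.
Proof.
by move=> g; apply: autL_eq => u /=; rewrite /autL_inv; case: cid => h [/= + _].
Qed.
Fact autL_Vmul : right_inverse autL_one autL_inv autL_mul.
Proof.
by move=> g; apply: autL_eq => u /=; rewrite /autL_inv; case: cid => h [/= _].
Qed.
HB.instance Definition _ :=
  isGroup.Build (autL R) autL_mulA autL_mul1 autL_1mul autL_mulV autL_Vmul.

Lemma autL_mulE (g h : autL R) u : (g * h)%g u = g (h u).
Proof. by []. Qed.
Lemma autL_mulVE (g : autL R) u : (g^-1)%g (g u) = u.
Proof. by rewrite -autL_mulE mulVg. Qed.
Lemma autL_0 (g : autL R) : g 0 = 0.
Proof. by have := aut_linear g (-1) 0 0; rewrite scaleN1r addNr scaleN1r addNr. Qed.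
Lemma autL_Z (g : autL R) a u : g (a *: u) = a *: g u.
Proof.
by rewrite -[a *: u]addr0 aut_linear autL_0 addr0.
Qed.
Lemma autL_D (g : autL R) u v : g (u + v) = g u + g v.
Proof. by rewrite -[u in LHS]scale1r aut_linear scale1r. Qed.

Definition scalar_set (g : autL R) : Prop := exists a : E, forall u, g u = a *: u.

Fact scalar_1 : scalar_set 1%g.
Proof. by exists 1 => u; rewrite scale1r. Qed.
Fact scalar_M g h : scalar_set g -> scalar_set h -> scalar_set (g * h)%g.
Proof.
by move=> [a ga] [b hb]; exists (a * b) => u; rewrite autL_mulE ga hb scalerA.
Qed.
Fact scalar_J g h : scalar_set g -> scalar_set (g ^ h)%g.
Proof.
move=> [a ga]; exists a => u.
by rewrite conjgE !autL_mulE ga autL_Z autL_mulVE.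
Qed.
Fact scalar_V g : scalar_set g -> scalar_set (g^-1)%g.
Proof.
move=> [a ga].
have wE : hform (wP R) (wP R) = 3 by apply: form_wP_wP.
have aa : eis_val a * conjc (eis_val a) = 1.
  have := aut_form g (wP R) (wP R); rewrite !ga formZr -form_conj formZr wE.
  rewrite rmorphM rmorph_nat mulrA => /eqP.
  by rewrite -[X in _ == X]mul1r (inj_eq (mulIf _)) ?pnatr_eq0 // => /eqP.
exists (Eisenstein (eis_conj a)) => u.
apply: (can_inj (autL_mulVE g)); rewrite -autL_mulE mulgV autL_Z ga scalerA.
rewrite [X in X *: _](_ : _ = 1) ?scale1r //.
by apply/val_inj; rewrite /= mulrC.
Qed.
Definition scalars : normal_sub (autL R) :=
  NormalSub scalar_1 scalar_M scalar_V scalar_J.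

Definition PAut : Type := group_quot scalars.
HB.instance Definition _ := Group.on PAut.
Definition PAut_class (g : autL R) : PAut := gq_pi scalars g.

Definition latF : set L := [set u | exists a b : E, u = a *: wP R + b *: wL R].

(* A class h satisfies h(F) = F iff one (equivalently, each) of its lifts does,
   since the scalars in Aut(L) are multiplications by units of Z[omega]. *)
Definition GammaF : set PAut :=
  [set h | exists2 g : autL R, h = PAut_class g & g @` latF = latF].

End Automorphisms.

Arguments latF : clear implicits.
Arguments GammaF : clear implicits.

(* F^C = F (x) C is identified with C^2 through the basis (w_P, w_L) of F: the
   row (a, b) stands for a w_P + b w_L. *)

Notation FC R := 'rV[R[i]]_2.

Section FixedC.
Variable R : realType.
Local Notation E := (eisenstein R).
Local Notation L := (latL R).
Local Notation C := (R[i]).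

Definition wF (i : 'I_2) : L := if i == 0 then wP R else wL R.

Definition hformC (x y : FC R) : C :=
  \sum_i \sum_j conjc (x 0 i) * hform (wF i) (wF j) * y 0 j.

Definition wPC : FC R := delta_mx 0 0.
Definition wLC : FC R := delta_mx 0 1.
Definition z0 : FC R := wPC + theta R *: wLC.
Definition rhobar : FC R :=
  (2 * (4 + (Num.sqrt (3 : R))%:C))^-1 *: (wPC + xi R *: wLC).

Definition lincomb (a : 'rV[E]_2) : L := \sum_i a 0 i *: wF i.
Definition coordF (u : L) : 'rV[E]_2 := xget 0 [set a | u = lincomb a].

Lemma lincombE a : lincomb a = a 0 0 *: wP R + a 0 1 *: wL R.
Proof.
rewrite /lincomb big_ord_recl [X in _ + X]big_ord_recl big_ord0 [X in _ + X]addr0.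
by rewrite (_ : lift ord0 ord0 = 1) //; apply/val_inj.
Qed.

Lemma lincomb_inj : injective lincomb.
Proof.
suff h (a b : E) : a *: wP R + b *: wL R = 0 -> a = 0 /\ b = 0.
  move=> a b /eqP; rewrite -subr_eq0 !lincombE => /eqP e.
  have [] := h (a 0 0 - b 0 0) (a 0 1 - b 0 1).
    by rewrite !scalerBl addrACA -opprD.
  move=> /subr0_eq e0 /subr0_eq e1; apply/rowP => i.
  case: i => -[|[|//]] hi; first by rewrite [Ordinal hi](_ : _ = 0) //; apply/val_inj.
  by rewrite [Ordinal hi](_ : _ = 1) //; apply/val_inj.
move=> e.
have e1 : eis_val a * 3 + eis_val b * (4 * pC R) = 0.
  by have := congr1 (hform (wP R)) e; rewrite form0r formDZr formZr form_wP_wP form_wP_wL.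
have e2 : eis_val a * (4 * conjc (pC R)) + eis_val b * 3 = 0.
  have := congr1 (hform (wL R)) e; rewrite form0r formDZr formZr form_wL_wL.
  by rewrite -[hform (wL R) (wP R)]form_conj form_wP_wL rmorphM rmorph_nat.
have pp := p_norm R.
have n39 : (39 : C) != 0 by rewrite pnatr_eq0.
have a0 : eis_val a = 0.
  apply: (mulIf n39); rewrite mul0r; apply/eqP; rewrite -oppr_eq0; apply/eqP.
  transitivity (3 * (eis_val a * 3 + eis_val b * (4 * pC R)) -
      4 * pC R * (eis_val a * (4 * conjc (pC R)) + eis_val b * 3)); last first.
    by rewrite e1 e2 !mulr0 subr0.
  transitivity (eis_val a * (9 - 16 * (pC R * conjc (pC R)))); last by ring.
  by rewrite pp; ring.
have b0 : eis_val b = 0.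
  have n3 : (3 : C) != 0 by rewrite pnatr_eq0.
  by apply: (mulIf n3); move: e2; rewrite a0 !mul0r add0r.
by split; apply/val_inj.
Qed.

Lemma coordFK a : coordF (lincomb a) = a.
Proof.
rewrite /coordF; case: xgetP => [b _ /= /lincomb_inj -> //|/(_ a) /=].
by case.
Qed.

(* The matrix, acting on rows from the right, of the C-linear extension to F^C
   of the restriction of g to F, when g(F) = F (see extCE). *)
Definition extC (g : autL R) : 'M[C]_2 :=
  \matrix_(i, j) eis_val (coordF (g (wF i)) 0 j).

Definition toFC (u : L) : FC R := map_mx (@eis_val R) (coordF u).

Lemma toFC_lincomb a : toFC (lincomb a) = map_mx (@eis_val R) a.
Proof. by rewrite /toFC coordFK. Qed.

Lemma extCE (g : autL R) u : g @` latF R = latF R -> latF R u ->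
  toFC (g u) = toFC u *m extC g.
Proof.
move=> gF Fu.
have FE v : latF R v -> v = lincomb (coordF v).
  move=> [a [b ->]].
  pose c : 'rV[E]_2 := \row_i if i == 0 then a else b.
  by rewrite (_ : _ + _ = lincomb c) ?coordFK // lincombE !mxE.
have gw i : g (wF i) = lincomb (coordF (g (wF i))).
  apply: FE; rewrite -gF; exists (wF i) => //.
  rewrite /wF; case: ifP => _.
    by exists 1, 0; rewrite scale1r scale0r addr0.
  by exists 0, 1; rewrite scale1r scale0r add0r.
have [a ua] : exists a, u = lincomb a by exists (coordF u); apply: FE.
pose M : 'M[E]_2 := \matrix_(i, j) coordF (g (wF i)) 0 j.
have gu : g u = lincomb (a *m M).
  have gs : g u = \sum_i a 0 i *: g (wF i).
    rewrite ua /lincomb (big_morph g (autL_D g) (autL_0 g)).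
    by apply: eq_bigr => i _; apply: autL_Z.
  rewrite gs /lincomb.
  under [RHS]eq_bigr => j _ do rewrite mxE scaler_suml.
  rewrite exchange_big; apply: eq_bigr => i _; rewrite {1}gw /lincomb scaler_sumr.
  by apply: eq_bigr => j _; rewrite scalerA mxE.
rewrite gu ua [LHS]toFC_lincomb [X in _ = X *m _]toFC_lincomb; apply/rowP => j; rewrite !mxE.
transitivity (\sum_k eis_val (a 0 k * M k j)).
  by apply: (big_morph (@eis_val R)).
by apply: eq_bigr => k _; rewrite !mxE.
Qed.

Definition act_line (g : autL R) (U : {vspace FC R}) : {vspace FC R} :=
  (linfun (mulmxr (extC g)) @: U)%VS.

End FixedC.

Section Hyperbolic.
Variable R : realType.

(* inverse of cosh on [1, +oo) *)
Definition arcosh (t : R) : R := ln (t + Num.sqrt (t ^+ 2 - 1)).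

Lemma arcoshK t : 1 <= t -> (expR (arcosh t) + expR (- arcosh t)) / 2 = t.
Proof.
move=> t1; set s := Num.sqrt (t ^+ 2 - 1).
have s0 : 0 <= s by apply: sqrtr_ge0.
have ss : s ^+ 2 = t ^+ 2 - 1 by rewrite sqr_sqrtr // subr_ge0 exprn_ege1.
have ts : 0 < t + s by lra.
rewrite /arcosh -/s expRN lnK ?posrE //.
have tsn : t + s != 0 by rewrite gt_eqF.
rewrite (_ : (t + s)^-1 = t - s); first by field.
by apply: (mulfI tsn); rewrite mulfV // mulrC -subr_sqr ss; ring.
Qed.

Lemma arcosh_ge0 t : 1 <= t -> 0 <= arcosh t.
Proof.
by move=> t1; rewrite ln_ge0 // (le_trans t1) // lerDl sqrtr_ge0.
Qed.

Definition hnormC (x : FC R) : R := Num.sqrt (complex.Re (hformC x x)).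

(* d([x], [y]), computed on representatives *)
Definition dP (x y : FC R) : R :=
  arcosh (Normc.normc (hformC x y) / (hnormC x * hnormC y)).

(* P_+(F^C), as a set of one-dimensional subspaces of F^C *)
Definition Pplus : set {vspace FC R} :=
  [set U | exists x : FC R, 0 < hformC x x /\ U = <[x]>%VS].

Definition upper : set R[i] := [set tau | 0 < complex.Im tau].

Definition dH (tau tau' : R[i]) : R :=
  arcosh (2^-1 * (Num.sqrt (complex.Im tau))^-1 * (Num.sqrt (complex.Im tau'))^-1
          * Normc.normc (tau' - conjc tau)).

(* beta extends to the boundary point [z] with value b: beta [x] tends to b
   as the positive vector x tends to z *)
Definition boundary_value (beta : {vspace FC R} -> R[i]) (z : FC R) (b : R[i]) :=
  forall e : R, 0 < e -> exists2 d : R, 0 < d &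
    forall x : FC R, 0 < hformC x x ->
      (forall j, Normc.normc (x 0 j - z 0 j) < d) ->
      Normc.normc (beta <[x]>%VS - b) < e.

Definition mobius (M : SL2 R) (tau : R[i]) : R[i] :=
  ((M 0 0)%:C * tau + (M 0 1)%:C) / ((M 1 0)%:C * tau + (M 1 1)%:C).

Definition psl_act (m : PSL2 R) (tau : R[i]) : R[i] := mobius (repr m) tau.

Lemma psl_actE (M : SL2 R) tau : psl_act (PSL2_class M) tau = mobius M tau.
Proof.
have : pm1_set (M^-1 * repr (PSL2_class M))%g.
  by have := gq_repr (pm1 R) M.
set N := repr _; rewrite /pm1_set /mkset SL2_mulE => h.
have MM : (M : 'M[R]_2) *m (M^-1)%g = 1%:M by rewrite -SL2_mulE mulgV.
rewrite /psl_act -/N.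
have [e|e] : (N = M :> 'M[R]_2) \/ (N = - (M : 'M[R]_2) :> 'M[R]_2).
  by case: h => h; [left|right];
    rewrite -[LHS]mul1mx -MM -mulmxA h ?mulmxN mulmx1.
- by rewrite /mobius e.
- rewrite /mobius e !mxE !rmorphN /= !mulNr -!opprD invrN mulrNN //.
Qed.

End Hyperbolic.

Arguments Pplus : clear implicits.
Arguments upper : clear implicits.

Section Arithmetic.
Variable R : realType.

Fact SL2_map_subproof (M : SL2 int) :
  \det (map_mx intr (M : 'M[int]_2) : 'M[R]_2) == 1.
Proof. by rewrite det_map_mx (eqP (SL2_det M)). Qed.
Definition SL2_map (M : SL2 int) : SL2 R := MkSL2 (SL2_map_subproof M).

(* the image of an element of SL_2(Z) in PSL_2(Z), seen inside PSL_2(R) *)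
Definition PSL2_int (M : SL2 int) : PSL2 R := PSL2_class (SL2_map M).

Definition PSL2Z : set (PSL2 R) := range PSL2_int.

Definition principal_congruence (N : nat) : set (PSL2 R) :=
  PSL2_int @` [set M : SL2 int | forall i j, (M i j = (i == j)%:R %[mod N%:Z])%Z].

Definition Gamma0 (N : nat) : set (PSL2 R) :=
  PSL2_int @` [set M : SL2 int | (N%:Z %| (M : 'M[int]_2) 1%R 0%R)%Z].

Fact det_nu : \det (mx2 0 1 (-1) 5 : 'M[int]_2) == 1.
Proof. by rewrite det_mx2. Qed.
Fact det_S : \det (mx2 0 (-1) 1 0 : 'M[int]_2) == 1.
Proof. by rewrite det_mx2. Qed.

Definition nu : PSL2 R := PSL2_int (MkSL2 det_nu).
Definition S_PSL2 : PSL2 R := PSL2_int (MkSL2 det_S).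

End Arithmetic.

Arguments PSL2Z : clear implicits.
Arguments principal_congruence : clear implicits.
Arguments Gamma0 : clear implicits.

(* Main.v *)
(** The prescribed values force beta to be the quotient of two linear forms U, V on
F^C, and the Hermitian form is theta (conj(U) V' - conj(V) U'); this makes beta an
isometry and each element of Gamma_F a real unimodular matrix M up to a unit scalar s.

In the coordinates (U, V) the lattice F is the set of (u, v) in Z[omega]^2 with
5 u + v = 0 modulo the prime pi = 1 + 4 omega of norm 13, for which omega = 3.  Hence
an integral M preserves F up to scalars exactly when (5, 1) is an eigenvector of M
modulo 13, i.e. when nu M nu^-1 lies in Gamma_0(13).

Conversely, all points have the same projection to F^C, and so do all lines.  An
isometry T of F therefore extends to L by the identity on the orthogonal complement of
F as soon as T - 1 maps these two projections into F.  For T = s M this only asks that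
the unit s of Z[omega] be inverse to the eigenvalue of M modulo pi, which is possible
when the eigenvalue is a square modulo 13; the other half of the group is reached by
composing with a polarity, whose eigenvalue is a non-square. *)

From HB Require Import structures.
Require Import Defs.
From mathcomp Require Import all_boot all_order all_algebra.
From mathcomp Require Import complex ring lra zify.
From mathcomp Require Import all_classical all_reals all_analysis.

Import Order.TTheory GRing.Theory Num.Theory.

Local Open Scope classical_set_scope.
Local Open Scope complex_scope.
Local Open Scope ring_scope.

Set Implicit Arguments.
Unset Strict Implicit.
Unset Printing Implicit Defensive.

(** * Indices, sums and matrices of size two *)

Lemma ord2_ind (P : 'I_2 -> Prop) : P 0 -> P 1 -> forall i, P i.
Proof.
move=> P0 P1 [[|[|//]] hi]; first by rewrite (_ : Ordinal hi = 0) //; apply/val_inj.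
by rewrite (_ : Ordinal hi = 1) //; apply/val_inj.
Qed.

Lemma sum_ord2 (V : nmodType) (F : 'I_2 -> V) : \sum_i F i = F 0 + F 1.
Proof.
by rewrite big_ord_recl big_ord1; congr (_ + F _); apply/val_inj.
Qed.

Lemma mx2_eta (A : comNzRingType) (M : 'M[A]_2) :
  M = mx2 (M 0 0) (M 0 1) (M 1 0) (M 1 1).
Proof.
by apply/matrixP; apply: ord2_ind; apply: ord2_ind; rewrite !mxE.
Qed.

Lemma SL2_detE (A : comNzRingType) (M : SL2 A) : M 0 0 * M 1 1 - M 0 1 * M 1 0 = 1.
Proof. by rewrite -det_mx2 -mx2_eta; apply/eqP/SL2_det. Qed.

(** * Complex conjugation and values of Eisenstein integers *)

Section Conj.
Variable R : rcfType.
Implicit Types a b : R[i].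

Lemma conjcD a b : conjc (a + b) = conjc a + conjc b.
Proof. exact: rmorphD. Qed.
Lemma conjcN a : conjc (- a) = - conjc a.
Proof. exact: rmorphN. Qed.
Lemma conjcB a b : conjc (a - b) = conjc a - conjc b.
Proof. exact: rmorphB. Qed.
Lemma conjcM a b : conjc (a * b) = conjc a * conjc b.
Proof. exact: rmorphM. Qed.
Lemma conjc_nat n : conjc (n%:R : R[i]) = n%:R.
Proof. exact: rmorph_nat. Qed.
Lemma conjc_int (m : int) : conjc (m%:~R : R[i]) = m%:~R.
Proof. exact: rmorph_int. Qed.

Lemma conjc_sum (I : Type) (r : seq I) (P : pred I) (F : I -> R[i]) :
  conjc (\sum_(i <- r | P i) F i) = \sum_(i <- r | P i) conjc (F i).
Proof. exact: rmorph_sum. Qed.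

Lemma real_complex_int (m : int) : (m%:~R : R)%:C = m%:~R :> R[i].
Proof. exact: rmorph_int. Qed.

Definition conjcE := (conjcD, conjcN, conjcM, conjc_nat, conjc_int, conjc0, conjc1, conjcK).

End Conj.

Section EisVal.
Variable R : realType.
Implicit Types a b : eisenstein R.

Lemma eis_valM a b : eis_val (a * b) = eis_val a * eis_val b.
Proof. by []. Qed.
Lemma eis_valD a b : eis_val (a + b) = eis_val a + eis_val b.
Proof. by []. Qed.
Lemma eis_valN a : eis_val (- a) = - eis_val a.
Proof. by []. Qed.
Lemma eis_val1 : eis_val (1 : eisenstein R) = 1.
Proof. by []. Qed.
Lemma eis_val0 : eis_val (0 : eisenstein R) = 0.
Proof. by []. Qed.

End EisVal.

(** * Cartesian coordinates and algebraic relations of the constants *)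

Section Constants.
Variable R : realType.
Local Notation C := (R[i]).
Local Notation w := (omega R).
Local Notation r := (Num.sqrt (3 : R)).

Lemma sqr_sqrt3 : r * r = 3.
Proof. by rewrite -expr2 sqr_sqrtr. Qed.

Lemma sqrt3_gt0 : 0 < r.
Proof. by rewrite sqrtr_gt0. Qed.

Lemma sin_2pi3 : sin (2 * pi / 3 : R) = r / 2.
Proof.
have s0 : 0 < sin (2 * pi / 3 : R).
  apply: sin_gt0_pi; have := @pi_gt0 R => pi0.
  by apply/andP; split; lra.
have := cos2Dsin2 (2 * pi / 3 : R); rewrite cos_2pi3 => e.
apply/eqP; rewrite -(@eqrXn2 _ 2) ?divr_ge0 ?ltW ?sqrtr_ge0 //.
by apply/eqP; have := sqr_sqrt3; lra.
Qed.

Lemma omegaE_cart : w = (- 2^-1) +i* (r / 2).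
Proof. by rewrite /omega /cis cos_2pi3 sin_2pi3. Qed.

Lemma xiE_cart : xi R = (r / 2) +i* (- 2^-1).
Proof.
have e : pi / 6 = 2 * pi / 3 - pi / 2 :> R by field.
rewrite /xi /cis cosN sinN e cosB sinB cos_pihalf sin_pihalf cos_2pi3 sin_2pi3.
by congr (_ +i* _); lra.
Qed.

(** The minimal equation of [omega]. Once [theta], [pC] and the conjugates are written in [w], every
    identity over Z[omega] is a ring identity modulo this relation. *)
Lemma omega_sqr : w ^+ 2 = - 1 - w.
Proof.
rewrite omegaE_cart; apply/eqP; rewrite eq_complex /=; apply/andP.
by split; apply/eqP; have := sqr_sqrt3; lra.
Qed.

Lemma conj_omega : conjc w = - 1 - w.
Proof. by rewrite omegaJ omega_sqr. Qed.

Lemma thetaE : theta R = 1 + 2 * w.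
Proof. by rewrite /theta conj_omega; ring. Qed.

Lemma conj_p : conjc (pC R) = 1 - w.
Proof. by rewrite pJ_def omega_sqr; ring. Qed.

Lemma theta_cart : theta R = 0 +i* r.
Proof.
rewrite thetaE omegaE_cart; apply/eqP; rewrite eq_complex /=; apply/andP.
by split; apply/eqP; have := sqr_sqrt3; lra.
Qed.

Lemma theta_neq0 : theta R != 0.
Proof. by rewrite theta_cart eq_complex /= eqxx gt_eqF ?sqrt3_gt0. Qed.

Lemma conj_theta : conjc (theta R) = - theta R.
Proof. by rewrite theta_cart; apply/eqP; rewrite eq_complex /= oppr0 !eqxx. Qed.

End Constants.

(** * The two linear forms on F^C and the Hermitian form in terms of them *)

Section Beta.
Variable R : realType.
Local Notation C := (R[i]).
Local Notation w := (omega R).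
Local Notation r := (Num.sqrt (3 : R)).
Implicit Types x y : FC R.

(* Up to a common scalar, the linear forms whose quotient takes the prescribed
   values at z_0, w_P and w_L. *)
Definition beta_num x : C := x 0 1 - theta R * x 0 0.
Definition beta_den x : C := (-1 - w) * x 0 0 - pC R * x 0 1.

Lemma hformCE x y : hformC x y =
  3 * (conjc (x 0 0) * y 0 0) + 4 * pC R * (conjc (x 0 0) * y 0 1)
  + 4 * conjc (pC R) * (conjc (x 0 1) * y 0 0) + 3 * (conjc (x 0 1) * y 0 1).
Proof.
rewrite /hformC !sum_ord2 /wF eqxx.
rewrite (_ : (1 == 0 :> 'I_2) = false) //.
rewrite -[hform (wL R) (wP R)]form_conj form_wP_wP form_wL_wL form_wP_wL.
by rewrite conjcM conjc_nat; ring.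
Qed.

(* In the coordinates (beta_num, beta_den) the Hermitian form is the standard
   form of signature (1,1) on C^2 that has the upper half plane as its positive cone. *)
Lemma hformC_num_den x y : hformC x y =
  theta R * (conjc (beta_num x) * beta_den y - conjc (beta_den x) * beta_num y).
Proof.
rewrite hformCE /beta_num /beta_den !(conj_theta, conj_omega, conj_p, conjcE) thetaE /pC.
by ring: (omega_sqr R).
Qed.

End Beta.

(** * The map beta: isometry, bijectivity and prescribed values *)

Section BetaMap.
Variable R : realType.
Local Notation C := (R[i]).
Local Notation w := (omega R).
Local Notation r := (Num.sqrt (3 : R)).
Local Notation normc := (@Normc.normc R).
Implicit Types x y : FC R.

Definition beta_pt x : C := beta_num x / beta_den x.
(** The vector picked in the line is immaterial, since [beta_pt] is homogeneous of degree 0; see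
    [beta_line]. *)
Definition beta (U : {vspace FC R}) : C := beta_pt (vpick U).

Lemma beta_numZ a x : beta_num (a *: x) = a * beta_num x.
Proof. by rewrite /beta_num !mxE; ring. Qed.
Lemma beta_denZ a x : beta_den (a *: x) = a * beta_den x.
Proof. by rewrite /beta_den !mxE; ring. Qed.
Lemma beta_ptZ a x : a != 0 -> beta_pt (a *: x) = beta_pt x.
Proof. by move=> a0; rewrite /beta_pt beta_numZ beta_denZ -mulf_div divff ?mul1r. Qed.

Lemma beta_line x : x != 0 -> beta <[x]>%VS = beta_pt x.
Proof.
move=> x0; have /vlineP[k e] : vpick <[x]>%VS \in <[x]>%VS by apply: memv_pick.
rewrite /beta e beta_ptZ //; apply: contra_neq x0 => k0.
have : vpick <[x]>%VS == 0 by rewrite e k0 scale0r.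
by rewrite vpick0 => /eqP e0; apply/eqP; rewrite -memv0 -e0 memv_line.
Qed.

(** This number is the determinant of the change of coordinates from (w_P, w_L) to ([beta_num],
    [beta_den]). Multiplying it by its conjugate gives its norm 13. *)
Lemma norm13_neq0 : 1 + 4 * w != 0 :> C.
Proof.
apply/eqP => e; have := congr1 (fun z => z * (1 + 4 * conjc w)) e.
rewrite mul0r conj_omega => /eqP.
rewrite [X in X == 0](_ : _ = 13) ?pnatr_eq0 //.
by ring: (omega_sqr R).
Qed.

Lemma num_den_inj x y :
  beta_num x = beta_num y -> beta_den x = beta_den y -> x = y.
Proof.
rewrite /beta_num /beta_den => en ed.
have p13 := norm13_neq0.
(* Cramer's rule for the change of coordinates; [e1] is the second row. *)
have e0 z : (1 + 4 * w) * z 0 0 =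
    - pC R * (z 0 1 - theta R * z 0 0) - ((-1 - w) * z 0 0 - pC R * z 0 1) :> C.
  by rewrite thetaE /pC; ring: (omega_sqr R).
have e1 z : (1 + 4 * w) * z 0 1 = (1 + w) * (z 0 1 - theta R * z 0 0)
    - theta R * ((-1 - w) * z 0 0 - pC R * z 0 1) :> C.
  by rewrite thetaE /pC; ring: (omega_sqr R).
by apply/rowP; apply: ord2_ind; apply: (mulfI p13); rewrite (e0, e1) en ed -(e0, e1).
Qed.

(** The inverse change of coordinates, as the adjugate divided by the determinant. *)
Definition of_num_den (a b : C) : FC R := (1 + 4 * w)^-1 *:
  \row_i (if i == 0 then - pC R * a - b else (1 + w) * a - theta R * b).

Lemma hformC_beta x y : beta_den x != 0 -> beta_den y != 0 ->
  hformC x y = theta R * (conjc (beta_den x) * beta_den y)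
               * (conjc (beta_pt x) - beta_pt y).
Proof.
move=> hx hy; rewrite hformC_num_den -[beta_num x](divfK hx) -[beta_num y](divfK hy).
by rewrite -/(beta_pt x) -/(beta_pt y) conjcM; ring.
Qed.

Lemma conjc_mulr (z : C) : conjc z * z = ((normc z) ^+ 2)%:C.
Proof.
case: z => a b; rewrite /= sqr_sqrtr ?addr_ge0 ?sqr_ge0 //.
by apply/eqP; rewrite eq_complex /=; apply/andP; split; apply/eqP; ring.
Qed.

(** [theta] is i times the square root of 3, and conj(tau) - tau = -2i Im tau. *)
Lemma hformC_diag x : beta_den x != 0 ->
  hformC x x = (2 * r * (normc (beta_den x)) ^+ 2 * complex.Im (beta_pt x))%:C.
Proof.
move=> hx; rewrite hformC_beta // conjc_mulr theta_cart.
case: (beta_pt x) => a b.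
by apply/eqP; rewrite eq_complex /=; apply/andP; split; apply/eqP; ring.
Qed.

Lemma normc_gt0 (z : C) : z != 0 -> 0 < normc z.
Proof.
move=> z0; rewrite lt_def; apply/andP; split; last by case: (z) => a b; apply: sqrtr_ge0.
by apply: contra_neq z0; apply: Normc.eq0_normc.
Qed.

Lemma hformC_gt0 x :
  0 < hformC x x <-> beta_den x != 0 /\ 0 < complex.Im (beta_pt x).
Proof.
have pos : beta_den x != 0 -> (0 < hformC x x) = (0 < complex.Im (beta_pt x)).
  move=> hx; rewrite hformC_diag // ltcR pmulr_rgt0 //.
  by rewrite !mulr_gt0 ?sqrt3_gt0 ?exprn_gt0 ?normc_gt0.
split=> [h|[hx]]; last by rewrite pos.
(* A vector with vanishing denominator is isotropic. *)
have hx : beta_den x != 0.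
  apply: contraTneq h => e.
  by rewrite hformC_num_den e conjc0 mulr0 mul0r subrr mulr0 ltxx.
by split=> //; rewrite -pos.
Qed.

Lemma pos_neq0 x : 0 < hformC x x -> x != 0.
Proof.
move=> /hformC_gt0[h _]; apply: contra_neq h => ->.
by rewrite /beta_den !mxE; ring.
Qed.

(** By [hformC_beta] and [hformC_diag] the absolute values of the denominators cancel in the
    argument of [arcosh]. The remaining constant is r / (2 r), the factor 1/2 in the metric of the
    half plane. *)
Lemma beta_isometry x y : 0 < hformC x x -> 0 < hformC y y ->
  dH (beta <[x]>%VS) (beta <[y]>%VS) = dP x y.
Proof.
move=> px py; rewrite !beta_line ?pos_neq0 //.
have /hformC_gt0[dx ix] := px; have /hformC_gt0[dy iy] := py.
have nx := normc_gt0 dx; have ny := normc_gt0 dy.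
have r0 := sqrt3_gt0 R.
have sq z : beta_den z != 0 -> 0 < complex.Im (beta_pt z) ->
    hnormC z = Num.sqrt (2 * r) * normc (beta_den z) * Num.sqrt (complex.Im (beta_pt z)).
  move=> dz iz; have nz := normc_gt0 dz; rewrite /hnormC hformC_diag //=.
  rewrite sqrtrM; last by rewrite mulr_ge0 ?sqr_ge0 // ltW ?mulr_gt0.
  rewrite sqrtrM; last by rewrite ltW ?mulr_gt0.
  by rewrite sqrtr_sqr ger0_norm // ltW.
rewrite /dH /dP !sq // hformC_beta // !Normc.normcM.
have nt : normc (theta R) = r.
  by rewrite theta_cart /= expr0n add0r sqrtr_sqr ger0_norm // ltW.
have nj (z : C) : normc (conjc z) = normc z by case: z => a b /=; rewrite sqrrN.
have -> : normc (conjc (beta_pt x) - beta_pt y) = normc (beta_pt y - conjc (beta_pt x)).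
  by rewrite -normcN opprB.
rewrite nt nj; congr arcosh.
have s2 : Num.sqrt (2 * r) * Num.sqrt (2 * r) = 2 * r.
  by rewrite -expr2 sqr_sqrtr // ltW ?mulr_gt0.
have : Num.sqrt (2 * r) != 0 by rewrite gt_eqF // sqrtr_gt0 mulr_gt0.
have : Num.sqrt (complex.Im (beta_pt x)) != 0 by rewrite gt_eqF // sqrtr_gt0.
have : Num.sqrt (complex.Im (beta_pt y)) != 0 by rewrite gt_eqF // sqrtr_gt0.
have rE : r = Num.sqrt (2 * r) * Num.sqrt (2 * r) / 2 by rewrite s2; field.
rewrite [X in _ = X * _ * _ / _]rE.
move: (Num.sqrt (2 * r)) (Num.sqrt _) (Num.sqrt _) => a b c c0 b0 a0.
by field; rewrite a0 b0 c0 !gt_eqF.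
Qed.

Lemma of_num_denK a b :
  beta_num (of_num_den a b) = a /\ beta_den (of_num_den a b) = b.
Proof.
have p13 := norm13_neq0.
rewrite /of_num_den beta_numZ beta_denZ; split.
  apply: (mulfI p13); rewrite mulVKf // /beta_num !mxE /= thetaE /pC.
  by ring: (omega_sqr R).
apply: (mulfI p13); rewrite mulVKf // /beta_den !mxE /= thetaE /pC.
by ring: (omega_sqr R).
Qed.

Lemma beta_bij : set_bij (Pplus R) (upper R) beta.
Proof.
split.
- move=> _ [x [px ->]]; rewrite /upper /= beta_line ?pos_neq0 //.
  by have /hformC_gt0[] := px.
- move=> _ _ /set_mem[x [px ->]] /set_mem[y [py ->]].
  rewrite !beta_line ?pos_neq0 // => e.
  have /hformC_gt0[dx _] := px; have /hformC_gt0[dy _] := py.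
  (* Equal quotients make the coordinates of [x] and [y] proportional, hence the vectors too. *)
  have xy : x = (beta_den x / beta_den y) *: y.
    apply: num_den_inj; last by rewrite beta_denZ divfK.
    rewrite beta_numZ -[LHS](divfK dx) -/(beta_pt x) e /beta_pt.
    by rewrite mulrC mulrA mulrAC.
  apply/eqP; rewrite eqEsubv; apply/andP; split; rewrite -memvE; apply/vlineP.
    by exists (beta_den x / beta_den y).
  exists (beta_den y / beta_den x); rewrite {2}xy scalerA.
  by rewrite [X in X *: _](_ : _ = 1) ?scale1r //; field; rewrite dx dy.
- move=> tau tau0; have [en ed] := of_num_denK tau 1.
  set x := of_num_den tau 1 in en ed.
  have px : 0 < hformC x x.
    by apply/hformC_gt0; rewrite /beta_pt en ed divr1 oner_eq0.
  exists <[x]>%VS; first by exists x.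
  by rewrite beta_line ?pos_neq0 // /beta_pt en ed divr1.
Qed.

Lemma rhobar_neq0 : (2 * (4 + r%:C))^-1 != 0 :> C.
Proof.
rewrite invr_neq0 // mulf_neq0 ?pnatr_eq0 // eq_complex /= negb_and.
by apply/orP; left; rewrite gt_eqF // !addr_gt0 ?sqrt3_gt0.
Qed.

Lemma beta_rhobar : beta <[rhobar R]>%VS = 0 +i* 1.
Proof.
have r0 := sqrt3_gt0 R; have rr := sqr_sqrt3 R.
have x0 : wPC R + xi R *: wLC R != 0.
  apply/eqP => /rowP /(_ 0) /eqP; rewrite !mxE /= mulr0 addr0.
  by rewrite oner_eq0.
rewrite beta_line ?scaler_eq0 ?negb_or ?rhobar_neq0 //.
rewrite beta_ptZ ?rhobar_neq0 // /beta_pt /beta_num /beta_den !mxE /=.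
rewrite theta_cart xiE_cart /pC omegaE_cart !(mulr0, mulr1, addr0, add0r).
set d := (X in _ / X).
have d0 : d != 0.
  rewrite /d eq_complex /= negb_and; apply/orP; left.
  by apply/eqP; nra.
apply: (mulIf d0); rewrite divfK // /d; apply/eqP; rewrite eq_complex /=.
by apply/andP; split; apply/eqP; nra.
Qed.

Lemma p_neq0 : pC R != 0.
Proof.
apply/eqP => e; have := p_norm R; rewrite e mul0r => /eqP.
by rewrite eq_sym pnatr_eq0.
Qed.

Lemma beta_wP : beta <[wPC R]>%VS = pC R.
Proof.
have x0 : wPC R != 0.
  by apply/eqP => /rowP /(_ 0) /eqP; rewrite !mxE /= oner_eq0.
rewrite beta_line // /beta_pt /beta_num /beta_den !mxE /=.
have d0 : - 1 - w != 0 :> C.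
  by rewrite omegaE_cart eq_complex /= negb_and; apply/orP; left; apply/eqP; lra.
apply: (mulIf d0); rewrite !(mulr0, mulr1, subr0, sub0r) divfK // thetaE /pC.
by ring: (omega_sqr R).
Qed.

Lemma beta_wL : beta <[wLC R]>%VS = - (pC R)^-1.
Proof.
have x0 : wLC R != 0.
  by apply/eqP => /rowP /(_ 1) /eqP; rewrite !mxE /= oner_eq0.
rewrite beta_line // /beta_pt /beta_num /beta_den !mxE /=.
by rewrite !(mulr0, mulr1, subr0, sub0r) invrN mulrN mul1r.
Qed.

(** At z_0 the numerator vanishes and the denominator is -1 - 4 omega, of absolute value at least
    3. *)
Lemma beta_z0 : boundary_value beta (z0 R) 0.
Proof.
have r0 := sqrt3_gt0 R; have rr := sqr_sqrt3 R.
have r2 : r <= 2 by nra.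
(* The bound 1/2 keeps the denominator at least 1 in absolute value; the numerator is at most 3 d,
   and the bound e/4 makes this less than e. *)
move=> e e0; exists (Num.min (2^-1) (e / 4)); first by rewrite lt_min invr_gt0 ltr0n divr_gt0.
move=> x px near; rewrite beta_line ?pos_neq0 // subr0 /beta_pt Normc.normcM Normc.normcV.
have near0 := near 0; have near1 := near 1.
move: near0 near1; set d := Num.min _ _; set d0 := (X in normc X < d -> _).
set d1 := (X in _ -> normc X < d -> _) => h0 h1.
have dh : d <= 2^-1 by rewrite ge_min lexx.
have de : d <= e / 4 by rewrite ge_min lexx orbT.
have en : beta_num x = d1 - theta R * d0.
  by rewrite /beta_num /d0 /d1 !mxE /=; ring.
have ed : beta_den x = (-1 - 4 * w) + ((-1 - w) * d0 - pC R * d1).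
  by rewrite /beta_den /d0 /d1 !mxE /= thetaE /pC; ring: (omega_sqr R).
have nB (a b : C) : normc (a - b) <= normc a + normc b.
  by rewrite -(normcN b) le_normcD.
have nw : normc (-1 - w) = 1.
  rewrite -conj_omega omegaE_cart /= (_ : _ + _ = 1) ?sqrtr1 //; nra.
have np : normc (pC R) = r.
  by rewrite /pC omegaE_cart /=; congr Num.sqrt; nra.
have nt : normc (theta R) = r.
  by rewrite theta_cart /= expr0n add0r sqrtr_sqr ger0_norm // ltW.
have n13 : 3 <= normc (-1 - 4 * w).
  have n9 : Num.sqrt (3 ^+ 2) = 3 :> R by rewrite sqrtr_sqr ger0_norm.
  rewrite omegaE_cart /= -[X in X <= _]n9 ler_wsqrtr //; nra.
have n0 (z : C) : 0 <= normc z by case: z => a b; apply: sqrtr_ge0.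
have rd0 : r * normc d0 <= 2 * normc d0 by rewrite ler_wpM2r.
have rd1 : r * normc d1 <= 2 * normc d1 by rewrite ler_wpM2r.
have lnum : normc (beta_num x) <= 3 * d.
  rewrite en; apply: le_trans (nB _ _) _; rewrite Normc.normcM nt.
  lra.
have lden : 1 <= normc (beta_den x).
  have := nB (beta_den x) ((-1 - w) * d0 - pC R * d1).
  rewrite {1}ed addrK; have := nB ((-1 - w) * d0) (pC R * d1).
  rewrite !Normc.normcM nw np; lra.
rewrite ltr_pdivrMr; nra.
Qed.
End BetaMap.

(** * Stabilizers of F as real unimodular matrices up to a scalar *)

Section Stabilizer.
Variable R : realType.
Local Notation C := (R[i]).
Local Notation E := (eisenstein R).
Implicit Types (x y : FC R) (g h : autL R).

Definition stabF g : Prop := g @` latF R = latF R.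

Lemma latFP u : latF R u <-> exists a : 'rV[E]_2, u = lincomb a.
Proof.
split=> [[a [b ->]]|[a ->]]; last by exists (a 0 0), (a 0 1); rewrite lincombE.
by exists (\row_i if i == 0 then a else b); rewrite lincombE !mxE.
Qed.

Lemma lincombZ (a : E) (v : 'rV[E]_2) : lincomb (a *: v) = a *: lincomb v.
Proof.
by rewrite /lincomb scaler_sumr; apply: eq_bigr => i _; rewrite scalerA mxE.
Qed.

Lemma wF_lincomb i : wF R i = lincomb (delta_mx 0 i).
Proof.
move: i; apply: ord2_ind; rewrite lincombE !mxE /= /wF.
  by rewrite scale1r scale0r addr0.
by rewrite scale1r scale0r add0r.
Qed.

Lemma stabF_latF g u : stabF g -> latF R u -> latF R (g u).
Proof. by move=> gF Fu; rewrite -gF; exists u. Qed.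

Lemma stabF_wF g i : stabF g -> g (wF R i) = lincomb (coordF (g (wF R i))).
Proof.
move=> gF; have /latFP[a ->] : latF R (g (wF R i)).
  by apply: stabF_latF => //; apply/latFP; exists (delta_mx 0 i); apply: wF_lincomb.
by rewrite coordFK.
Qed.

Lemma row_extC g i : row i (extC g) = toFC (g (wF R i)).
Proof. by apply/rowP => j; rewrite !mxE. Qed.

Lemma stabFM g h : stabF g -> stabF h -> stabF (g * h)%g.
Proof.
move=> gF hF; apply/seteqP; split=> [_ [u Fu <-]|u Fu].
  by rewrite autL_mulE; apply: stabF_latF gF _; apply: stabF_latF hF Fu.
have [v Fv <-] : (g @` latF R) u by rewrite gF.
have [v' Fv' <-] : (h @` latF R) v by rewrite hF.
by exists v'.
Qed.

(** The order is reversed because [extC] acts on rows from the right. *)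
Lemma extCM g h : stabF g -> stabF h -> extC (g * h)%g = extC h *m extC g.
Proof.
move=> gF hF; apply/row_matrixP => i.
rewrite row_mul !row_extC autL_mulE extCE //; apply: stabF_latF => //.
by apply/latFP; exists (delta_mx 0 i); apply: wF_lincomb.
Qed.

Lemma hformC_lincomb (a b : 'rV[E]_2) :
  hformC (map_mx (@eis_val R) a) (map_mx (@eis_val R) b) = hform (lincomb a) (lincomb b).
Proof.
rewrite {2}/lincomb form_sumr /hformC exchange_big; apply: eq_bigr => j _ /=.
rewrite Defs.formZr -form_conj /lincomb form_sumr conjc_sum mulr_sumr.
apply: eq_bigr => i _; rewrite Defs.formZr conjcM form_conj !mxE.
by rewrite mulrC.
Qed.

Lemma hformC_extC g x y : stabF g ->
  hformC (x *m extC g) (y *m extC g) = hformC x y.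
Proof.
move=> gF.
have hE i j : hformC (row i (extC g)) (row j (extC g)) = hform (wF R i) (wF R j).
  by rewrite !row_extC /toFC hformC_lincomb -!stabF_wF // aut_form.
have hB (z z' : FC R) : hformC z z' =
    \sum_i \sum_j conjc (z 0 i) * z' 0 j * hform (wF R i) (wF R j).
  by rewrite /hformC; apply: eq_bigr => i _; apply: eq_bigr => j _; rewrite mulrAC.
(* Both sides are determined by the Gram matrix of the basis, which the rows of [T] share by
   [hE]. *)
move: (extC g) hE => T hE; rewrite [RHS]hB !sum_ord2 -!hE !hformCE !mxE !sum_ord2 !(conj_p, conjcD, conjcM).
by ring.
Qed.

(** In the coordinates ([beta_num], [beta_den]), written as a column, [T] is the matrix s M. This
    restores the order of products reversed in [extCM]. *)
Definition acts_as (T : 'M[C]_2) (s : C) (M : SL2 R) : Prop :=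
  forall x, beta_num (x *m T)
      = s * ((M 0 0)%:C * beta_num x + (M 0 1)%:C * beta_den x)
    /\ beta_den (x *m T)
      = s * ((M 1 0)%:C * beta_num x + (M 1 1)%:C * beta_den x).

Definition represents g (M : SL2 R) : Prop :=
  exists2 s : C, s * conjc s = 1 & acts_as (extC g) s M.

Lemma conjc_real (a : R) : conjc (a%:C) = a%:C.
Proof. by apply/eqP; rewrite eq_complex /= oppr0 !eqxx. Qed.

Lemma SL2_detC (M : SL2 R) : (M 0 0)%:C * (M 1 1)%:C - (M 0 1)%:C * (M 1 0)%:C = 1 :> C.
Proof. by rewrite -!rmorphM -rmorphB SL2_detE. Qed.

(** The determinant does not depend on the coordinates, and that of s M is s^2. The proof multiplies
    by the determinant 1 + 4 omega of the change of coordinates and cancels it. *)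
Lemma acts_as_det T s M : acts_as T s M -> T 0 0 * T 1 1 - T 0 1 * T 1 0 = s ^+ 2.
Proof.
move=> hs; apply: (mulfI (norm13_neq0 R)).
have [h1 h2] := hs (wPC R); have [h3 h4] := hs (wLC R); have := SL2_detC M.
move: h1 h2 h3 h4; rewrite -!rowE /beta_num /beta_den !mxE /= !(mulr0, mulr1, subr0, sub0r).
move: (M 0 0)%:C (M 0 1)%:C (M 1 0)%:C (M 1 1)%:C => a b c d h1 h2 h3 h4 det1.
transitivity ((T 0 1 - theta R * T 0 0) * ((-1 - omega R) * T 1 0 - pC R * T 1 1)
    - (T 1 1 - theta R * T 1 0) * ((-1 - omega R) * T 0 0 - pC R * T 0 1)).
  by rewrite thetaE /pC; ring: (omega_sqr R).
transitivity ((1 + 4 * omega R) * s ^+ 2 * (a * d - b * c)); last by rewrite det1 mulr1.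
by rewrite h1 h2 h3 h4 thetaE /pC; ring: (omega_sqr R).
Qed.

(** In the new coordinates the form is theta times the determinant of conj(x) and y. The real matrix
    M commutes with conjugation, so the form is multiplied by |s|^2 det M = 1. *)
Lemma acts_as_form T s M x y : s * conjc s = 1 -> acts_as T s M ->
  hformC (x *m T) (y *m T) = hformC x y.
Proof.
move=> ss hs; rewrite !hformC_num_den.
rewrite (hs x).1 (hs x).2 (hs y).1 (hs y).2; have := SL2_detC M.
move: (beta_num x) (beta_den x) (beta_num y) (beta_den y) => u v u' v'.
rewrite !(conjc_real, conjcD, conjcM).
move: (M 0 0)%:C (M 0 1)%:C (M 1 0)%:C (M 1 1)%:C => a b c d det1.
transitivity (theta R * ((s * conjc s) * (a * d - b * c) * (conjc u * v' - conjc v * u'))).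
  by ring.
by rewrite ss det1 !mul1r.
Qed.

Lemma representsM g h M N : stabF g -> stabF h ->
  represents g M -> represents h N -> represents (g * h)%g (M * N)%g.
Proof.
move=> gF hF [s s0 hs] [t t0 ht]; exists (s * t).
  by rewrite conjcM mulrACA s0 t0 mulr1.
move=> x; rewrite extCM // mulmxA; have [-> ->] := hs (x *m extC h).
have [-> ->] := ht x; rewrite SL2_mulE !mxE !sum_ord2.
by rewrite !rmorphD !rmorphM /=; split; ring.
Qed.

Lemma real_complex_conj (z : C) : conjc z = z -> z = (complex.Re z)%:C.
Proof.
case: z => a b [] /= e; apply/eqP; rewrite eq_complex /= eqxx; apply/eqP; lra.
Qed.

(* An isometry of the form [hformC_num_den] satisfies [z = D * conjc z] for each of
   its entries, D being its determinant; dividing by a square root of D makes it real. *)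
Lemma represents_ex g : stabF g -> exists M, represents g M.
Proof.
move=> gF; pose u := of_num_den (1 : C) 0; pose v := of_num_den (0 : C) 1.
have [nu du] := of_num_denK (1 : C) 0; have [nv dv] := of_num_denK (0 : C) 1.
rewrite -/u in nu du; rewrite -/v in nv dv.
pose a := beta_num (u *m extC g); pose c := beta_den (u *m extC g).
pose b := beta_num (v *m extC g); pose d := beta_den (v *m extC g).
(* [u] and [v] are isotropic with product theta, and so are their images; this gives [e1], [e2] and
   [e3]. *)
have e1 : conjc a * c = conjc c * a.
  apply/eqP; rewrite -subr_eq0 -(inj_eq (mulfI (theta_neq0 R))) mulr0.
  by rewrite -hformC_num_den hformC_extC // hformC_num_den nu du !conjcE; apply/eqP; ring.
have e2 : conjc b * d = conjc d * b.
  apply/eqP; rewrite -subr_eq0 -(inj_eq (mulfI (theta_neq0 R))) mulr0.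
  by rewrite -hformC_num_den hformC_extC // hformC_num_den nv dv !conjcE; apply/eqP; ring.
have e3 : conjc a * d - conjc c * b = 1.
  apply: (mulfI (theta_neq0 R)).
  by rewrite -hformC_num_den hformC_extC // hformC_num_den nu nv du dv !conjcE; ring.
have ua : beta_num (u *m extC g) = a := erefl _.
have vb : beta_num (v *m extC g) = b := erefl _.
have uc : beta_den (u *m extC g) = c := erefl _.
have vd : beta_den (v *m extC g) = d := erefl _.
clearbody a b c d u v.
have e3' : a * conjc d - c * conjc b = 1.
  by rewrite -[RHS]conjc1 -e3 conjcB !conjcM !conjcK.
pose D := a * d - b * c.
have Da : D * conjc a = a.
  by rewrite -[RHS]mulr1 -e3 /D; ring: e1.
have Db : D * conjc b = b.
  by rewrite -[RHS]mulr1 -e3' /D; ring: e2.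
have Dc : D * conjc c = c.
  by rewrite -[RHS]mulr1 -e3 /D; ring: e1.
have Dd : D * conjc d = d.
  by rewrite -[RHS]mulr1 -e3' /D; ring: e2.
have DD : D * conjc D = 1.
  by rewrite -e3' -[in RHS]Da -[in X in _ - X]Dc /D conjcB !conjcM; ring.
pose s := sqrtc D; have sD : s * s = D by rewrite -expr2 sqr_sqrtc.
have ss : s * conjc s = 1.
  (* The square of s conj(s) is D conj(D) = 1, and -1 is excluded because s conj(s) is a squared
     absolute value. *)
  have : (s * conjc s) ^+ 2 == 1 by rewrite -DD -sD conjcM; apply/eqP; ring.
  rewrite -sqr_normc sqrf_eq1 => /orP[/eqP //|/eqP e].
  have := exprn_ge0 2 (normr_ge0 s); rewrite e oppr_ge0.
  by rewrite real_leNgt ?real1 ?real0 // ltr01.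
have re (z : C) : D * conjc z = z -> z * conjc s = (complex.Re (z * conjc s))%:C.
  move=> Dz; apply: real_complex_conj.
  by rewrite conjcM conjcK -[in RHS]Dz -sD -[LHS]mulr1 -ss; ring.
pose m (z : C) := complex.Re (z * conjc s).
have mE (z : C) : D * conjc z = z -> (m z)%:C = z * conjc s by move=> /re.
have mdet : \det (mx2 (m a) (m b) (m c) (m d)) == 1.
  apply/eqP/(@complexI R); rewrite det_mx2 rmorphB !rmorphM /= !mE //.
  transitivity (D * (conjc s * conjc s)); first by rewrite /D; ring.
  by rewrite -sD; transitivity ((s * conjc s) * (s * conjc s)); [ring | rewrite ss mulr1].
exists (MkSL2 mdet), s => //.
have hn (y z : FC R) : beta_num (y + z) = beta_num y + beta_num z.
  by rewrite /beta_num !mxE; ring.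
have hd (y z : FC R) : beta_den (y + z) = beta_den y + beta_den z.
  by rewrite /beta_den !mxE; ring.
move=> x; have xE : x = beta_num x *: u + beta_den x *: v.
  apply: num_den_inj; first by rewrite hn !beta_numZ nu nv; ring.
  by rewrite hd !beta_denZ du dv; ring.
rewrite {1 4}xE !mulmxDl -!scalemxAl hn hd !(beta_numZ, beta_denZ) !mxE /= !mE //.
rewrite ua vb uc vd.
by split; rewrite -[LHS]mulr1 -ss; ring.
Qed.

(** Comparing the determinants of N = t M gives t^2 = 1. *)
Lemma real_SL2_pm1 (M N : SL2 R) (t : C) :
  (forall i j, (N i j)%:C = t * (M i j)%:C) -> PSL2_class M = PSL2_class N.
Proof.
move=> h.
have t2 : t ^+ 2 == 1.
  apply/eqP; rewrite -[LHS]mulr1 -[X in _ * X](SL2_detC M) -[RHS](SL2_detC N) !h; ring.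
have MM : (M^-1)%g *m M = 1%:M :> 'M[R]_2 by apply: SL2_mulVE.
apply/(gq_pi_eq (pm1 R)); move: t2 h; rewrite sqrf_eq1 => /orP[]/eqP-> h; [left|right].
  have -> : N = M; last by rewrite SL2_mulE.
  by apply/val_inj/matrixP => i j; apply: (@complexI R); rewrite h mul1r.
rewrite SL2_mulE (_ : (N : 'M[R]_2) = - (M : 'M[R]_2)) ?mulmxN ?MM //.
apply/matrixP => i j; apply: (@complexI R).
by rewrite [LHS]h mxE rmorphN /= mulN1r.
Qed.

(** A change of sign of the matrix is absorbed by the scalar. *)
Lemma represents_class g M N :
  represents g M -> PSL2_class M = PSL2_class N -> represents g N.
Proof.
move=> [s ss hs] /gq_pi_eq hMN.
have NE : (N : 'M[R]_2) = (M : 'M[R]_2) *m (M^-1 * N)%g by rewrite -SL2_mulE mulgA mulgV mul1g.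
case: hMN NE => -> NE; first by exists s => // x; have := hs x; rewrite NE mulmx1.
exists (- s); first by rewrite conjcN mulrNN.
move=> x; have [-> ->] := hs x; rewrite NE mulmxN mulmx1 !mxE !rmorphN /=.
by split; ring.
Qed.

(** Two lifts of a class differ by a scalar, so their matrices are proportional and [real_SL2_pm1]
    applies. Hence [cbeta] does not depend on the lift. *)
Lemma represents_uniq g h M N : stabF g ->
  PAut_class g = PAut_class h -> represents g M -> represents h N ->
  PSL2_class M = PSL2_class N.
Proof.
move=> gF /gq_pi_eq[a ha] [s _ hs] [t tt ht].
have t0 : t != 0.
  by apply/eqP => e; move: tt; rewrite e mul0r => /eqP; rewrite eq_sym oner_eq0.
have hE u : h u = a *: g u.
  by rewrite -autL_Z -ha -!autL_mulE mulgA mulgV mul1g.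
have eh : extC h = eis_val a *: extC g.
  apply/row_matrixP => i; rewrite row_extC linearZ /= row_extC hE stabF_wF //.
  rewrite (_ : a *: _ = lincomb (a *: coordF (g (wF R i)))).
    rewrite [LHS]toFC_lincomb [X in _ = _ *: X]toFC_lincomb; apply/rowP => j.
    by rewrite mxE [in LHS]mxE eis_valM [in RHS]mxE [in RHS]mxE.
  by rewrite lincombZ.
apply: (@real_SL2_pm1 _ _ (t^-1 * eis_val a * s)) => i j.
apply: (mulfI t0); rewrite !mulrA mulfV // mul1r.
pose u := of_num_den (1 : C) 0; pose v := of_num_den (0 : C) 1.
have [nu du] := of_num_denK (1 : C) 0; have [nv dv] := of_num_denK (0 : C) 1.
rewrite -/u in nu du; rewrite -/v in nv dv; clearbody u v.
have hu := ht u; have hv := ht v; have gu := hs u; have gv := hs v.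
rewrite eh -!scalemxAr beta_numZ beta_denZ gu.1 gu.2 nu du !(mulr0, mulr1, addr0) !mulrA in hu.
rewrite eh -!scalemxAr beta_numZ beta_denZ gv.1 gv.2 nv dv !(mulr0, mulr1, add0r) !mulrA in hv.
case: hu hv => h00 h10 [h01 h11].
by move: i j; apply: ord2_ind; apply: ord2_ind.
Qed.

End Stabilizer.

(** * The homomorphism c_beta and its action on the half plane *)

Section Cbeta.
Variable R : realType.
Local Notation C := (R[i]).
Local Notation E := (eisenstein R).
Implicit Types (x y : FC R) (g h : autL R).

(** On Gamma_F the set is inhabited by [represents_ex] and a single point by [represents_uniq];
    elsewhere it is empty and the value is the default 1. *)
Definition cbeta (h : PAut R) : PSL2 R := xget 1%g
  [set m | exists g M, [/\ h = PAut_class g, stabF g, represents g M & m = PSL2_class M]].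

Lemma cbetaE g M : stabF g -> represents g M -> cbeta (PAut_class g) = PSL2_class M.
Proof.
move=> gF gM; rewrite /cbeta; case: xgetP => [m _ [h [N [gh hF hN ->]]]|].
  by apply: (represents_uniq hF (esym gh) hN gM).
by move=> /(_ (PSL2_class M))[]; exists g, M.
Qed.

Lemma PAut_classM g h : PAut_class (g * h)%g = (PAut_class g * PAut_class h)%g.
Proof. exact: (gq_piM (scalars R)). Qed.

Lemma PSL2_classM (A : comNzRingType) (M N : SL2 A) :
  PSL2_class (M * N)%g = (PSL2_class M * PSL2_class N)%g.
Proof. exact: (gq_piM (pm1 A)). Qed.

Lemma cbetaM : {in GammaF R &, {morph cbeta : h k / (h * k)%g}}.
Proof.
move=> _ _ /set_mem[g -> gF] /set_mem[h -> hF].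
have [M gM] := represents_ex gF; have [N hN] := represents_ex hF.
rewrite -PAut_classM (cbetaE gF gM) (cbetaE hF hN) -PSL2_classM.
by apply: cbetaE; [apply: stabFM | apply: representsM].
Qed.

Lemma represents_mobius g M x : stabF g -> represents g M -> 0 < hformC x x ->
  beta_pt (x *m extC g) = mobius M (beta_pt x).
Proof.
move=> gF [s ss hs] px; have /hformC_gt0[dx ix] := px.
have s0 : s != 0.
  by apply/eqP => e; move: ss; rewrite e mul0r => /eqP; rewrite eq_sym oner_eq0.
have [en ed] := hs x; rewrite /beta_pt en ed -mulf_div divff // mul1r /mobius.
rewrite -[beta_num x in LHS](divfK dx) -/(beta_pt x) !mulrA -!mulrDl.
by rewrite -mulf_div divff // mulr1.
Qed.

Lemma cbeta_act g : stabF g -> forall U : {vspace FC R}, Pplus R U ->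
  beta (act_line g U) = psl_act (cbeta (PAut_class g)) (beta U).
Proof.
move=> gF _ [x [px ->]]; have [M gM] := represents_ex gF.
rewrite (cbetaE gF gM) psl_actE /act_line limg_line lfunE /=.
rewrite !beta_line ?pos_neq0 //; last by rewrite hformC_extC.
exact: represents_mobius.
Qed.

End Cbeta.

(** * Integer coordinates on Z[omega] *)

Section EisensteinCoordinates.
Variable R : realType.
Local Notation E := (eisenstein R).
Local Notation w := (omega R).

(** Horner's scheme: multiplication by omega sends a + b omega to -b + (a - b) omega. *)
Lemma eis_coord (z : E) : exists a b : int, eis_val z = a%:~R + b%:~R * w.
Proof.
case: z => _ /= /asboolP[q ->]; elim/poly_ind: q => [|q c [a [b IH]]].
  by exists 0, 0; rewrite rmorph0 horner0 mul0r addr0.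
exists (c - b), (a - b); rewrite rmorphD rmorphM /= map_polyX map_polyC /=.
rewrite hornerD hornerMX hornerC IH !intrB.
by ring: (omega_sqr R).
Qed.

Lemma eis_coord_inj (a b a' b' : int) :
  a%:~R + b%:~R * w = a'%:~R + b'%:~R * w -> a = a' /\ b = b'.
Proof.
rewrite omegaE_cart -!real_complex_int => /eqP; rewrite eq_complex /=.
have r0 := sqrt3_gt0 R.
move=> /andP[/eqP e1 /eqP e2].
have e3 : b%:~R = b'%:~R :> R.
  apply: (@mulIf _ (Num.sqrt 3 / 2)); first by rewrite gt_eqF // divr_gt0.
  by move: e2; rewrite !(mul0r, addr0, add0r).
split; apply: (@intr_inj R) => //.
by move: e1; rewrite e3 !(mul0r, subr0); lra.
Qed.

Definition eis (a b : int) : E := a%:~R + b%:~R * omegaE R.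

Lemma eis_valE a b : eis_val (eis a b) = a%:~R + b%:~R * w.
Proof.
have h (m : int) : eis_val (m%:~R : E) = m%:~R by apply: (rmorph_int (\val : E -> R[i])).
by rewrite eis_valD eis_valM !h.
Qed.

End EisensteinCoordinates.

(** * Integral matrices that come from Gamma_F satisfy the level condition *)

Section Integral.
Variable R : realType.
Local Notation C := (R[i]).
Local Notation E := (eisenstein R).
Local Notation w := (omega R).

Definition nuZ : SL2 int := MkSL2 det_nu.

Lemma SL2_mapM (M N : SL2 int) : SL2_map R (M * N)%g = (SL2_map R M * SL2_map R N)%g.
Proof. by apply/val_inj; rewrite /= map_mxM. Qed.

Lemma PSL2_intM (M N : SL2 int) : PSL2_int R (M * N)%g = (PSL2_int R M * PSL2_int R N)%g.
Proof. by rewrite /PSL2_int SL2_mapM PSL2_classM. Qed.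

Lemma PSL2_int1 : PSL2_int R 1%g = 1%g.
Proof.
by rewrite /PSL2_int (_ : SL2_map R 1%g = 1%g) //; apply/val_inj; rewrite /= map_mx1.
Qed.

Lemma PSL2_intV (M : SL2 int) : PSL2_int R M^-1%g = (PSL2_int R M)^-1%g.
Proof.
by apply: (mulgI (PSL2_int R M)); rewrite -PSL2_intM !mulgV PSL2_int1.
Qed.

(* Modulo 13 the combination is minus the lower left entry of [nu M nu^-1]. *)
Definition level13 (M : SL2 int) : bool :=
  (13%:Z %| 5 * M 0%R 0%R + M 0%R 1%R + M 1%R 0%R - 5 * M 1%R 1%R)%Z.

Lemma dvd_conj_nu (M : SL2 int) :
  (13%:Z %| (nuZ * M * nuZ^-1)%g 1%R 0%R)%Z = level13 M.
Proof.
have -> : (nuZ * M * nuZ^-1)%g 1 0 =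
    13 * (2 * M 1 0) - (5 * M 0 0 + M 0 1 + M 1 0 - 5 * M 1 1).
  have nV : (nuZ^-1)%g = mx2 5 (-1) 1 0 :> 'M[int]_2.
    have e : (mx2 5 (-1) 1 0 : 'M[int]_2) *m nuZ = 1%:M.
      by apply/matrixP; apply: ord2_ind; apply: ord2_ind; rewrite !mxE sum_ord2 !mxE.
    have nn : (nuZ : 'M[int]_2) *m (nuZ^-1)%g = 1%:M by rewrite -SL2_mulE mulgV.
    by rewrite -[RHS]mulmx1 -nn mulmxA e mul1mx.
  rewrite SL2_mulE mxE sum_ord2 nV !SL2_mulE !mxE !sum_ord2 !mxE /=.
  by ring.
by rewrite rpredBl ?dvdz_mulr.
Qed.

Lemma dvd13_sqr (m : int) : (13%:Z %| m ^+ 2)%Z -> (13%:Z %| m)%Z.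
Proof. by rewrite !dvdzE abszX Euclid_dvdX // => /andP[]. Qed.

(* With pi = 1 + 4 omega, of norm 13, one has [pi T_00 = s W] where W lies in Z[omega]
   and [s ^+ 2 = det T] is a unit; hence pi^2 divides W^2, so 13 divides the image of
   W under omega |-> 3, which is a multiple of the level condition. *)
Lemma represents_Gamma0 (g : autL R) (M : SL2 int) : stabF g ->
  represents g (SL2_map R M) -> level13 M.
Proof.
move=> gF [s ss hs].
have TE i j : exists t : E, extC g i j = eis_val t.
  by rewrite mxE; eexists.
have hP := hs (wPC R); have Ds := acts_as_det hs.
move: (extC g) TE hP Ds => T TE; rewrite -!rowE /beta_num /beta_den !mxE /=.
rewrite !real_complex_int.
have [t00 ->] := TE 0 0; have [t01 ->] := TE 0 1.
have [t10 ->] := TE 1 0; have [t11 ->] := TE 1 1.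
pose DE := t00 * t11 - t01 * t10.
have DE_val : eis_val DE = eis_val t00 * eis_val t11 - eis_val t01 * eis_val t10.
  by rewrite eis_valD eis_valN !eis_valM.
(* The determinant of T is s^2, with inverse its conjugate. The product of this conjugate and T_00^2
   lies in Z[omega] and eliminates [s] from the square of the identity [W]. *)
have [a [b]] := eis_coord (Eisenstein (eis_conj DE) * t00 * t00).
rewrite 2!eis_valM [eis_val (Eisenstein _)](_ : _ = conjc (eis_val DE)) // DE_val => ab.
rewrite /level13.
move: (M 0 0) (M 0 1) (M 1 0) (M 1 1) => m00 m01 m10 m11.
move: (eis_val t00) (eis_val t01) (eis_val t10) (eis_val t11) ab => u00 u01 u10 u11 ab.
rewrite !(mulr0, mulr1, subr0, sub0r) => -[h1 h2] Ds.
pose X : int := m01 + m10 + m11; pose Y : int := 3 * m00 + 2 * m01 + 2 * m10 + m11.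
have W : (1 + 4 * w) * u00 = s * (X%:~R + Y%:~R * w).
  transitivity (- pC R * (u01 - theta R * u00) - ((-1 - w) * u00 - pC R * u01)).
    by rewrite thetaE /pC; ring: (omega_sqr R).
  rewrite h1 h2 /X /Y !intrD !intrM thetaE /pC; ring: (omega_sqr R).
have ss2 : s ^+ 2 * conjc (s ^+ 2) = 1.
  by rewrite expr2 conjcM mulrACA ss mulr1.
have : (X ^+ 2 - Y ^+ 2)%:~R + (2 * X * Y - Y ^+ 2)%:~R * w =
    (- 15 * a + 8 * b)%:~R + (- 8 * a - 7 * b)%:~R * w.
  transitivity ((1 + 4 * w) ^+ 2 * (a%:~R + b%:~R * w)); last first.
    by rewrite !(intrD, intrB, intrM, intrN); ring: (omega_sqr R).
  rewrite -ab Ds; transitivity (conjc (s ^+ 2) * ((1 + 4 * w) * u00) ^+ 2); last by ring.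
  rewrite W; transitivity ((s ^+ 2 * conjc (s ^+ 2)) * (X%:~R + Y%:~R * w) ^+ 2); last by ring.
  rewrite ss2 !expr2 !(intrD, intrB, intrM, intrN); ring: (omega_sqr R).
move=> /eis_coord_inj[e1 e2].
(* [e1] plus three times [e2] is the equation evaluated at omega = 3, where (1 + 4 omega)^2 becomes
   0 modulo 13. *)
have : (13%:Z %| X + 3 * Y)%Z.
  apply: dvd13_sqr; rewrite [X in (_ %| X)%Z](_ : _ = 13 * (Y ^+ 2 - 3 * a - b)) ?dvdz_mulr //.
  by lia.
(* Modulo 13 the level condition is twice X + 3 Y. *)
rewrite /X /Y => /dvdzP[k hk]; apply/dvdzP; exists (2 * k - m00 - m01 - m10 - m11).
lia.
Qed.
End Integral.

(* Stated for abstract modules because unification in the quotient [latL R] unfolds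
   scalings down to the real numbers. *)
Section AbstractModule.
Variables (K : comNzRingType) (V : lmodType K).
Implicit Types (a b c d : K) (u v p q S : V).

Lemma linear_descent (U : lmodType K) (T : U -> V) (f : V -> V) (f0 : U -> V) :
  linear T -> linear f0 -> (forall u : U, f (T u) = f0 u) ->
  (forall v, exists u : U, v = T u) -> linear f.
Proof.
move=> Tl f0l fT Ts a u v; have [u' ->] := Ts u; have [v' ->] := Ts v.
by rewrite -Tl !fT f0l.
Qed.

Section LinearMap.
Variable f : V -> V.
Hypothesis fl : linear f.

Lemma linear_map0 : f 0 = 0.
Proof. by have := fl (-1) 0 0; rewrite scaleN1r addNr scaleN1r addNr. Qed.

Lemma linear_mapD u v : f (u + v) = f u + f v.
Proof. by rewrite -[u in LHS]scale1r fl scale1r. Qed.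

Lemma linear_mapZ a u : f (a *: u) = a *: f u.
Proof. by rewrite -[a *: u]addr0 fl linear_map0 addr0. Qed.

Lemma linear_map_sum (I : Type) (r : seq I) (P : pred I) (F : I -> V) :
  f (\sum_(i <- r | P i) F i) = \sum_(i <- r | P i) f (F i).
Proof. by apply: (big_morph f linear_mapD linear_map0). Qed.

Lemma linear_swap a b c p q : f p = c *: q -> f q = p ->
  f (a *: p + b *: q) = b *: p + (a * c) *: q.
Proof. by move=> fp fq; rewrite fl linear_mapZ fp fq scalerA addrC. Qed.

Lemma linear_map_comb c d d' v v' S S' : f v = v' -> f S = c *: S' -> d = c * d' ->
  f (d *: v + S) = c *: (d' *: v' + S').
Proof. by move=> fv fS ->; rewrite fl fv fS scalerDr scalerA. Qed.

Lemma linear_map_comb' c d d' v v' S S' : f v = c *: v' -> f S = S' -> d * c = d' ->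
  f (d *: v + S) = d' *: v' + S'.
Proof. by move=> fv fS <-; rewrite fl fv fS scalerA. Qed.

End LinearMap.

Lemma scale_unit a b u : b * a = 1 -> b *: (a *: u) = u.
Proof. by move=> ba; rewrite scalerA ba scale1r. Qed.

Lemma scale_comb a b c p q : c *: (a *: p + b *: q) = (c * a) *: p + (c * b) *: q.
Proof. by rewrite scalerDr !scalerA. Qed.

End AbstractModule.

(** * The Hermitian form of L in its first variable *)

Section FormLeft.
Variable R : realType.
Local Notation L := (latL R).
Local Notation E := (eisenstein R).
Implicit Types (u v : L) (a : E).

Lemma hformZl a u v : hform (a *: u) v = conjc (eis_val a) * hform u v.
Proof. by rewrite -form_conj Defs.formZr conjcM form_conj. Qed.

Lemma hformDl u v u' : hform (u + v) u' = hform u u' + hform v u'.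
Proof. by rewrite -form_conj Defs.formDr conjcD !form_conj. Qed.

Lemma hform_suml (I : finType) (f : I -> L) u :
  hform (\sum_i f i) u = \sum_i hform (f i) u.
Proof.
by rewrite -form_conj form_sumr conjc_sum; apply: eq_bigr => i _; rewrite form_conj.
Qed.

End FormLeft.

(** * The automorphism sigma attached to a polarity *)

Section Polarity.
Variables (R : realType) (lx : ppoint -> pline) (xl : pline -> ppoint).
Hypothesis pol : is_polarity lx xl.
Local Notation L := (latL R).
Local Notation E := (eisenstein R).
Local Notation w := (omega R).

Definition sig_vertex (v : vertex) : L :=
  match v with
  | inl x => - omegaE R *: vln R (lx x)
  | inr l => vpt R (xl l)
  end.

Definition sig_pre (u : preL R) : L := \sum_v (u v : E) *: sig_vertex v.

Lemma sig_preP a u v : sig_pre (a *: u + v) = a *: sig_pre u + sig_pre v.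
Proof.
rewrite /sig_pre scaler_sumr -big_split; apply: eq_bigr => i _ /=.
by rewrite scalerA -scalerDl !ffunE.
Qed.

Lemma sig_pre_basis v : sig_pre (preL_basis R v) = sig_vertex v.
Proof.
rewrite /sig_pre (bigD1 v) //= ffunE eqxx scale1r big1 ?addr0 // => u uv.
by rewrite ffunE (negPf uv) scale0r.
Qed.

(** The unit [- omega] has modulus one and takes p to its conjugate, which compensates for the
    exchange of points and lines. *)
Lemma form_sig_vertex v v' : hform (sig_vertex v) (sig_vertex v') = gram R v v'.
Proof.
have [K1 K2 K] := pol.
have ww : conjc (- w) * - w = 1 by rewrite conjcN conj_omega; ring: (omega_sqr R).
have pw : conjc (- w) * conjc (pC R) = pC R.
  by rewrite conjcN conj_omega conj_p /pC; ring: (omega_sqr R).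
have wp : - w * pC R = conjc (pC R) by rewrite conj_p /pC; ring: (omega_sqr R).
have ev : eis_val (- omegaE R) = - w by [].
case: v v' => [x|l] [x'|l'] /=.
- rewrite hformZl Defs.formZr ev mulrA ww mul1r form_ln_ln.
  by rewrite (inj_eq (can_inj K1)).
- by rewrite hformZl ev form_ln_pt -K; case: ifP; rewrite ?mulr0.
- by rewrite Defs.formZr ev form_pt_ln -K; case: ifP; rewrite ?mulr0.
- by rewrite form_pt_pt (inj_eq (can_inj K2)).
Qed.

Lemma form_sig_pre u v : hform (sig_pre u) (sig_pre v) = preform u v.
Proof.
rewrite /sig_pre hform_suml /preform; apply: eq_bigr => i _.
rewrite form_sumr; apply: eq_bigr => j _.
by rewrite hformZl Defs.formZr form_sig_vertex; ring.
Qed.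

(** The image is orthogonal to all [sig_vertex v]. Up to units these are all the points and lines,
    which separate the elements of L. *)
Lemma sig_pre_radical u : u \in @radical R -> sig_pre u = 0.
Proof.
have [K1 K2 K] := pol.
move=> /asboolP hu.
have h v : hform (sig_vertex v) (sig_pre u) = 0.
  by rewrite -sig_pre_basis form_sig_pre -preform_conj hu conjc0.
have w0 : conjc (eis_val (- omegaE R)) != 0.
  have e : conjc (- w) * - w = 1 by rewrite conjcN conj_omega; ring: (omega_sqr R).
  apply/eqP => h0; move: e; rewrite [conjc _]h0 mul0r => /eqP.
  by rewrite eq_sym oner_eq0.
apply: form_eq => [x|l]; rewrite Defs.form0r.
  by have := h (inr (lx x)); rewrite /= K1.
have := h (inl (xl l)); rewrite /= K2 hformZl => /eqP.
by rewrite mulf_eq0 (negPf w0) => /eqP.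
Qed.

Definition sig_fun (y : L) : L := sig_pre (repr y).

Lemma sig_funE u : sig_fun (toL u) = sig_pre u.
Proof.
have /toL_eqP/sig_pre_radical : toL (repr (toL u)) = toL u by rewrite toL_repr.
rewrite -[_ - u]addrC -scaleN1r sig_preP scaleN1r => /eqP.
by rewrite addrC subr_eq0 => /eqP.
Qed.

Lemma sig_pre_linear : linear sig_pre.
Proof. exact: sig_preP. Qed.

Lemma sig_linear : linear sig_fun.
Proof.
apply: (linear_descent (@toL_linear R) sig_pre_linear sig_funE) => y.
by exists (repr y); rewrite toL_repr.
Qed.

Lemma sig_form u v : hform (sig_fun u) (sig_fun v) = hform u v.
Proof.
by elim/toL_ind: u => u; elim/toL_ind: v => v; rewrite !sig_funE form_sig_pre formE.
Qed.

Lemma sig_ln l : sig_fun (vln R l) = vpt R (xl l).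
Proof. by rewrite {1}vln.unlock sig_funE sig_pre_basis. Qed.

Lemma sig_pt x : sig_fun (vpt R x) = - omegaE R *: vln R (lx x).
Proof. by rewrite {1}vpt.unlock sig_funE sig_pre_basis. Qed.

HB.instance Definition _ := GRing.isLinear.Build E L L _ sig_fun sig_linear.

Lemma sig_sqr y : sig_fun (sig_fun y) = - omegaE R *: y.
Proof.
have [K1 K2 K] := pol.
elim/toL_ind: y => u; rewrite sig_funE /sig_pre linear_sum.
rewrite [in RHS](preL_sum u) linear_sum scaler_sumr; apply: eq_bigr => v _.
rewrite !linearZ /= [in RHS]scalerA -[in RHS]scalerA; congr (_ *: _).
case: v => [x|l] /=.
  by rewrite linearZ /= sig_ln K1 vpt.unlock.
by rewrite sig_pt K2 vln.unlock.
Qed.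

(** With [sig_sqr] this makes (1 + omega) sigma the inverse of sigma. *)
Lemma sig_unit : (1 + omegaE R) * - omegaE R = 1.
Proof. by apply/val_inj; change ((1 + w) * - w = 1); ring: (omega_sqr R). Qed.

Lemma sig_bij : bijective sig_fun.
Proof.
exists (fun y => (1 + omegaE R) *: sig_fun y) => y.
  by rewrite sig_sqr; apply: scale_unit sig_unit.
by rewrite (linear_mapZ sig_linear) sig_sqr; apply: scale_unit sig_unit.
Qed.

Definition sig : autL R := AutL sig_linear sig_bij sig_form.

Lemma sigE y : sig y = sig_fun y.
Proof. by []. Qed.

Lemma sig_wP : sig (wP R) = - omegaE R *: wL R.
Proof.
(* w_L may be computed at any point; the image of [line0] is the one that matches. *)
have [K1 K2 K] := pol; rewrite sigE wP.unlock wL.unlock (wL_at_indep R _ (xl line0)).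
apply: (linear_map_comb sig_linear (sig_ln line0)); last first.
  apply/val_inj; change (eis_val (pbarE R) = - w * pC R).
  by rewrite pbarE_val conj_p /pC; ring: (omega_sqr R).
rewrite (linear_map_sum sig_linear) scaler_sumr [RHS](reindex lx) /=; last first.
  by exists xl => ? _; rewrite ?K1 ?K2.
by apply: eq_big => x; [exact: K | rewrite sig_pt].
Qed.

Lemma sig_wL : sig (wL R) = wP R.
Proof.
have [K1 K2 K] := pol; rewrite sigE wP.unlock wL.unlock (wP_at_indep R _ (lx point0)).
apply: (linear_map_comb' sig_linear (sig_pt point0)).
  rewrite (linear_map_sum sig_linear) [RHS](reindex xl) /=; last first.
    by exists lx => ? _; rewrite ?K1 ?K2.
  by apply: eq_big => l; [exact: K | rewrite sig_ln].
apply/val_inj; change (pC R * - w = eis_val (pbarE R)).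
by rewrite pbarE_val conj_p /pC; ring: (omega_sqr R).
Qed.

Lemma sig_latF u : latF R u -> latF R (sig u).
Proof.
move=> [a [b ->]]; exists b, (a * - omegaE R).
exact: (linear_swap sig_linear a b sig_wP sig_wL).
Qed.

Lemma sig_stabF : stabF sig.
Proof.
apply/seteqP; split=> [_ [u Fu <-]|u Fu]; first exact: sig_latF.
exists ((1 + omegaE R) *: sig u).
  have [a [b ->]] := sig_latF Fu.
  by exists ((1 + omegaE R) * a), ((1 + omegaE R) * b); apply: scale_comb.
by rewrite !sigE (linear_mapZ sig_linear) sig_sqr; apply: scale_unit sig_unit.
Qed.

Lemma sig_represents : represents sig (SL2_map R (MkSL2 det_S)).
Proof.
pose T : 'M[E]_2 := mx2 0 (- omegaE R) 1 0.
have eT : extC sig = map_mx (@eis_val R) T.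
  apply/row_matrixP => i; rewrite row_extC.
  rewrite (_ : sig (wF R i) = lincomb (row i T)).
    by rewrite toFC_lincomb; apply/rowP => j; rewrite !mxE.
  move: i; apply: ord2_ind.
    by rewrite [wF R 0](_ : _ = wP R) // sig_wP lincombE !mxE /= scale0r add0r.
  by rewrite [wF R 1](_ : _ = wL R) // sig_wL lincombE !mxE /= scale0r scale1r addr0.
(* The scalar is the conjugate of omega. *)
exists (-1 - w).
  by rewrite -conj_omega conjcK conj_omega; ring: (omega_sqr R).
move=> x; have e0 : (x *m extC sig) 0 0 = x 0 1.
  by rewrite eT mxE sum_ord2 !mxE /= mulr0 mulr1 add0r.
have e1 : (x *m extC sig) 0 1 = - w * x 0 0.
  rewrite eT mxE sum_ord2 !mxE /= mulr0 addr0 mulrC; congr (_ * _).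
rewrite /beta_num /beta_den e0 e1 !mxE /= thetaE /pC.
rewrite !real_complex_int.
by split; ring: (omega_sqr R).
Qed.

End Polarity.

(** * Maps that differ from the identity by a map into a submodule *)

Section Transvection.
Variables (K : comNzRingType) (V : lmodType K) (n : nat).
Variables (lc : 'rV[K]_n -> V) (f : V -> 'rV[K]_n) (G : 'M[K]_n).
Hypotheses (lcl : linear lc) (fl : linear f).
Hypothesis flc : forall a, f (lc a) = a *m G.

(** The identity on the kernel of [f], and 1 + G N on the image of [lc]. With [lincomb] and [fcoord]
    for [lc] and [f], that kernel is the orthogonal complement of F. *)
Definition transv (N : 'M[K]_n) (y : V) : V := y + lc (f y *m N).

Let lcD a b : lc (a + b) = lc a + lc b.
Proof. by rewrite -[a in LHS]scale1r lcl scale1r. Qed.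
Let lc0 : lc 0 = 0.
Proof. by have := lcl (-1) 0 0; rewrite scaleN1r addNr scaleN1r addNr. Qed.
Let fD a b : f (a + b) = f a + f b.
Proof. by rewrite -[a in LHS]scale1r fl scale1r. Qed.

Let f0 : f 0 = 0.
Proof. by have := fl (-1) 0 0; rewrite scaleN1r addNr scaleN1r addNr. Qed.
Let fZ a y : f (a *: y) = a *: f y.
Proof. by rewrite -[a *: y]addr0 fl f0 addr0. Qed.
Let lcZ a y : lc (a *: y) = a *: lc y.
Proof. by rewrite -[a *: y]addr0 lcl lc0 addr0. Qed.

Lemma transv_linear N : linear (transv N).
Proof.
by move=> a u v; rewrite /transv fl mulmxDl -scalemxAl lcl scalerDr addrACA.
Qed.

(** The composite is the map of the same kind with matrix N' + N + N' G N. *)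
Lemma transv_cancel N N' : N' + N + N' *m G *m N = 0 -> cancel (transv N') (transv N).
Proof.
move=> e y; rewrite /transv fD flc -addrA -lcD mulmxDl addrA -mulmxDr -!mulmxA -mulmxDr.
by rewrite mulmxA e mulmx0 lc0 addr0.
Qed.

Lemma transv_lc N a : transv N (lc a) = lc (a *m (1%:M + G *m N)).
Proof. by rewrite /transv flc -lcD mulmxDr mulmx1 mulmxA. Qed.

(** With T = 1 + G N, the matrix N' is -N T^-1. The second equation follows from (1 + N G) N = N
    T. *)
Lemma transv_inv N (u : K) : \det (1%:M + G *m N) * u = 1 ->
  let N' := - (u *: (N *m \adj (1%:M + G *m N))) in
  N' + N + N' *m G *m N = 0 /\ N + N' + N *m G *m N' = 0.
Proof.
set T := 1%:M + G *m N => Tu N'.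
have N'T : N' *m T = - N.
  rewrite /N' mulNmx -scalemxAl -mulmxA mul_adj_mx mul_mx_scalar scalerA.
  by rewrite mulrC Tu scale1r.
have NT : (1%:M + N *m G) *m N' = - N.
  have e : (1%:M + N *m G) *m N = N *m T.
    by rewrite /T mulmxDr mulmxDl mul1mx mulmx1 mulmxA.
  rewrite /N' mulmxN -scalemxAr mulmxA e -mulmxA mul_mx_adj mul_mx_scalar scalerA.
  by rewrite mulrC Tu scale1r.
split.
  by rewrite addrAC -mulmxA -[X in X + _ + _]mulmx1 -mulmxDr N'T addNr.
by rewrite -addrA -[X in _ + (X + _)]mul1mx -mulmxDl NT addrN.
Qed.

Variables (C : numFieldType) (h : V -> V -> C).
Hypothesis hDl : forall u v w, h (u + v) w = h u w + h v w.
Hypothesis hDr : forall u v w, h u (v + w) = h u v + h u w.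
Hypothesis hf0 : forall u a, f u = 0 -> h u (lc a) = 0 /\ h (lc a) u = 0.
Variables (m : nat) (G' : 'M[K]_n).
Hypothesis m0 : (0 < m)%N.
Hypothesis GG' : G' *m G = (m%:R)%:M.
Hypothesis hm : forall u v, h (m%:R *: u) (m%:R *: v) = m%:R ^+ 2 * h u v.

(* After multiplication by [m] every vector splits into a part in the image of
   [lc] and a part orthogonal to it, on which the transvection is the identity. *)
Lemma transv_form N : (forall a b, h (lc (a *m (1%:M + G *m N))) (lc (b *m (1%:M + G *m N)))
    = h (lc a) (lc b)) ->
  forall u v, h (transv N u) (transv N v) = h u v.
Proof.
move=> hT u v.
have split y : exists a z, [/\ m%:R *: y = lc a + z, f z = 0 &
    m%:R *: transv N y = lc (a *m (1%:M + G *m N)) + z].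
  (* Since G' G = m, subtracting [lc a] from m y leaves a vector killed by [f]. *)
  pose a := f y *m G'.
  have [z mE fz] : exists2 z, m%:R *: y = lc a + z & f z = 0.
    exists (m%:R *: y - lc a); first by rewrite addrC subrK.
    have -> : m%:R *: y - lc a = (-1) *: lc a + m%:R *: y by rewrite addrC scaleN1r.
    by rewrite fl flc -mulmxA GG' mul_mx_scalar fZ scaleN1r addNr.
  exists a, z; split=> //.
  have tz : transv N z = z by rewrite /transv fz mul0mx lc0 addr0.
  have tD y1 y2 : transv N (y1 + y2) = transv N y1 + transv N y2.
    by rewrite -[y1 in LHS]scale1r transv_linear scale1r.
  have -> : m%:R *: transv N y = transv N (m%:R *: y).
    by rewrite /transv fZ -scalemxAl lcZ scalerDr.
  by rewrite mE tD tz transv_lc.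
have [a [z [e1 z0 e2]]] := split u; have [b [z' [e1' z0' e2']]] := split v.
have mC : m%:R ^+ 2 != 0 :> C by rewrite expf_neq0 // pnatr_eq0 -lt0n.
apply: (mulfI mC); rewrite -!hm e1 e1' e2 e2' !(hDl, hDr) hT.
by rewrite !(hf0 _ z0).1 !(hf0 _ z0').2.
Qed.

End Transvection.

(** * Integral functionals on L that detect F *)

Section FixedCoordinates.
Variable R : realType.
Local Notation C := (R[i]).
Local Notation E := (eisenstein R).
Local Notation L := (latL R).
Local Notation w := (omega R).

Lemma form_basis_div (u : L) (c : C) :
  (forall v, exists e : E, hform u (toL (preL_basis R v)) = c * eis_val e) ->
  forall y, exists e : E, hform u y = c * eis_val e.
Proof.
move=> hb; elim/toL_ind=> y; rewrite [y]preL_sum linear_sum form_sumr.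
elim: (index_enum _) => [|v s [e IH]].
  by exists 0; rewrite big_nil eis_val0 mulr0.
have [e' he'] := hb v; exists ((y v : E) * e' + e).
by rewrite big_cons IH linearZ Defs.formZr he' eis_valD eis_valM; ring.
Qed.

Lemma form_wP_div (y : L) : exists e : E, hform (wP R) y = pC R * eis_val e.
Proof.
move: y; apply: form_basis_div => -[x|l]; rewrite -form_conj.
  exists 0; have := form_pt_wP R x line0.
  by rewrite wP.unlock vpt.unlock => ->; rewrite conjc0 eis_val0 mulr0.
exists 1; have := form_ln_wP R l line0.
by rewrite wP.unlock vln.unlock => ->; rewrite conjcK eis_val1 mulr1.
Qed.

Lemma form_wL_div (y : L) : exists e : E, hform (wL R) y = conjc (pC R) * eis_val e.
Proof.
move: y; apply: form_basis_div => -[x|l]; rewrite -form_conj.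
  exists 1; have := form_pt_wL R x point0.
  by rewrite wL.unlock vpt.unlock => ->; rewrite eis_val1 mulr1.
exists 0; have := form_ln_wL R l point0.
by rewrite wL.unlock vln.unlock => ->; rewrite conjc0 eis_val0 mulr0.
Qed.

(* The entries are the integral functionals <w_L, y> / \bar p and <w_P, y> / p,
   which take the values (1, 0) on points and (0, 1) on lines. *)
Definition fcoord (y : L) : 'rV[E]_2 := \row_i
  if i == 0 then sval (cid (form_wL_div y)) else sval (cid (form_wP_div y)).

Lemma fcoord0 y : hform (wL R) y = conjc (pC R) * eis_val (fcoord y 0 0).
Proof. by rewrite mxE /=; case: cid. Qed.

Lemma fcoord1 y : hform (wP R) y = pC R * eis_val (fcoord y 0 1).
Proof. by rewrite mxE /=; case: cid. Qed.

Lemma conj_p_neq0 : conjc (pC R) != 0.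
Proof.
apply/eqP => e; have := p_norm R; rewrite e mulr0 => /eqP.
by rewrite eq_sym pnatr_eq0.
Qed.

Lemma fcoord_eq y (a : 'rV[E]_2) :
  hform (wL R) y = conjc (pC R) * eis_val (a 0 0) ->
  hform (wP R) y = pC R * eis_val (a 0 1) -> fcoord y = a.
Proof.
rewrite fcoord0 fcoord1 => /(mulfI conj_p_neq0) e0 /(mulfI (p_neq0 R)) e1.
by apply/rowP; apply: ord2_ind; apply/val_inj.
Qed.

Lemma fcoord_linear : linear fcoord.
Proof.
move=> a u v; apply: fcoord_eq; rewrite Defs.formDZr.
  by rewrite !fcoord0 [in RHS]mxE [X in eis_val (X + _)]mxE eis_valD eis_valM; ring.
by rewrite !fcoord1 [in RHS]mxE [X in eis_val (X + _)]mxE eis_valD eis_valM; ring.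
Qed.

Lemma lincomb_linear : linear (@lincomb R).
Proof.
move=> a u v; rewrite /lincomb scaler_sumr -big_split; apply: eq_bigr => i _ /=.
by rewrite scalerA -scalerDl !mxE.
Qed.

(** The rows are the values of [fcoord] at w_P and w_L; the determinant is 16 - 3 = 13. *)
Definition gramF : 'M[E]_2 := mx2 4 (pbarE R) (pE R) 4.
Definition gramF_adj : 'M[E]_2 := mx2 4 (- pbarE R) (- pE R) 4.

Lemma eis_val_nat n : eis_val (n%:R : E) = n%:R.
Proof. exact: (rmorph_nat (\val : E -> R[i])). Qed.

Lemma fcoord_lincomb a : fcoord (lincomb a) = a *m gramF.
Proof.
have [g00 g01 g10 g11] : [/\ gramF 0 0 = 4, gramF 0 1 = pbarE R,
    gramF 1 0 = pE R & gramF 1 1 = 4] by rewrite !mxE.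
apply: fcoord_eq; rewrite lincombE Defs.formDZr Defs.formZr mxE sum_ord2.
  rewrite -[hform (wL R) (wP R)]form_conj form_wP_wL form_wL_wL conjcM conjc_nat.
  rewrite g00 g10 eis_valD !eis_valM pE_val eis_val_nat.
  have := p_norm R; move: (pC R) (conjc (pC R)) => p q pq.
  by rewrite -pq; ring.
rewrite form_wP_wL form_wP_wP g01 g11 eis_valD !eis_valM pbarE_val eis_val_nat.
have := p_norm R; move: (pC R) (conjc (pC R)) => p q pq.
by rewrite -pq; ring.
Qed.

Lemma gramF_adjK : gramF_adj *m gramF = (13%:R)%:M.
Proof.
have pp : pE R * pbarE R = 3.
  by apply/val_inj; rewrite [LHS](eis_valM (pE R)) pbarE_val p_norm [RHS]eis_val_nat.
apply/matrixP; apply: ord2_ind; apply: ord2_ind; rewrite !mxE sum_ord2 !mxE /=;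
  by ring: pp.
Qed.

End FixedCoordinates.

(** * Extending isometries of F to L *)

Section Extension.
Variable R : realType.
Local Notation C := (R[i]).
Local Notation E := (eisenstein R).
Local Notation L := (latL R).
Local Notation w := (omega R).

Lemma fcoord_orth (u : L) (a : 'rV[E]_2) : fcoord u = 0 ->
  hform u (lincomb a) = 0 /\ hform (lincomb a) u = 0.
Proof.
move=> u0.
have hL : hform (wL R) u = 0 by rewrite fcoord0 u0 mxE eis_val0 mulr0.
have hP : hform (wP R) u = 0 by rewrite fcoord1 u0 mxE eis_val0 mulr0.
have h : hform u (lincomb a) = 0.
  rewrite lincombE Defs.formDZr Defs.formZr -[hform u (wP R)]form_conj.
  by rewrite -[hform u (wL R)]form_conj hL hP conjc0 !mulr0 addr0.
by split=> //; rewrite -form_conj h conjc0.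
Qed.

Lemma map_eisM m n k (A : 'M[E]_(m, n)) (B : 'M[E]_(n, k)) :
  map_mx (@eis_val R) (A *m B) = map_mx (@eis_val R) A *m map_mx (@eis_val R) B.
Proof. exact: (map_mxM (\val : E -> C)). Qed.

(** The matrix T = 1 + G N has determinant s^2, with inverse [u] in Z[omega], so the transvection is
    invertible over Z[omega]. It preserves the form on F by [acts_as_form], hence on L by
    [transv_form]. *)
Lemma transv_extends (N : 'M[E]_2) (M : SL2 R) (s : C) (u : E) :
  s * conjc s = 1 -> eis_val u = conjc s ^+ 2 ->
  acts_as (map_mx (@eis_val R) (1%:M + gramF R *m N)) s M ->
  exists2 g : autL R, stabF g & represents g M.
Proof.
move=> ss us hs; pose T := 1%:M + gramF R *m N.
have detT : \det T * u = 1.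
  apply/val_inj; rewrite [LHS](eis_valM (\det T)) us (mx2_eta T) det_mx2.
  rewrite eis_valD eis_valN !eis_valM.
  have := acts_as_det hs; rewrite -/T !mxE => ->.
  by rewrite -exprMn ss expr1n.
have [c1 c2] := transv_inv detT.
set N' := - _ in c1 c2.
have flc := @fcoord_lincomb R.
have k1 := transv_cancel (@lincomb_linear R) (@fcoord_linear R) flc c1.
have k2 := transv_cancel (@lincomb_linear R) (@fcoord_linear R) flc c2.
have tl := transv_linear (@lincomb_linear R) (@fcoord_linear R) N.
have tform : forall y z, hform (transv (@lincomb R) (@fcoord R) N y)
    (transv (@lincomb R) (@fcoord R) N z) = hform y z.
  have hm y z : hform ((13%:R : E) *: y) ((13%:R : E) *: z) = 13%:R ^+ 2 * hform y z.
    by rewrite hformZl Defs.formZr eis_val_nat conjc_nat mulrA expr2.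
  apply: (transv_form (@lincomb_linear R) (@fcoord_linear R) flc (@hformDl R)
    (@Defs.formDr R) fcoord_orth (isT : 0 < 13)%N (gramF_adjK R) hm) => a b.
  have := acts_as_form (map_mx (@eis_val R) a) (map_mx (@eis_val R) b) ss hs.
  by rewrite -!map_eisM !hformC_lincomb; apply.
pose g : autL R := AutL tl (Bijective k2 k1) tform.
have glc a : g (lincomb a) = lincomb (a *m T).
  exact: (transv_lc (@lincomb_linear R) flc N a).
have gF : stabF g.
  apply/seteqP; split=> [_ [y /latFP[a ->] <-]|y /latFP[a ->]].
    by apply/latFP; exists (a *m T); apply: glc.
  exists (lincomb (a *m (1%:M + gramF R *m N'))); first by apply/latFP; eexists.
  rewrite -(transv_lc (@lincomb_linear R) flc N' a); exact: k1.
exists g; first exact: gF.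
exists s; first exact: ss.
rewrite (_ : extC g = map_mx (@eis_val R) T) //.
apply/row_matrixP => i; rewrite row_extC wF_lincomb glc toFC_lincomb.
by rewrite -rowE map_row.
Qed.

(* [s0 + s1 w] is a unit of Z[w]; w reduces to 3 modulo its prime 1 + 4 w of norm 13. *)
Definition eis_unit (s0 s1 : int) : Prop :=
  [\/ s0 = 1 /\ s1 = 0, s0 = 0 /\ s1 = 1 | s0 = -1 /\ s1 = -1] \/
  [\/ s0 = -1 /\ s1 = 0, s0 = 0 /\ s1 = -1 | s0 = 1 /\ s1 = 1].

Lemma eis_unit_norm s0 s1 : eis_unit s0 s1 -> s0 ^+ 2 - s0 * s1 + s1 ^+ 2 = 1.
Proof. by case=> [] [] [-> ->]. Qed.

(** Modulo 13 the row (5, 1) is a left eigenvector with eigenvalue 1/k. As the determinant is 1, the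
    column (1, -5) annihilated by that row has eigenvalue k, whence k = a - 5 b. *)
Lemma unit_reduction (a b c d k : int) : a * d - b * c = 1 ->
  (13%:Z %| k * (5 * b + d) - 1)%Z -> (13%:Z %| k * (5 * a + c) - 5)%Z ->
  (13%:Z %| a - 5 * b - k)%Z.
Proof.
move=> det1 /dvdzP[i hi] /dvdzP[j hj]; apply/dvdzP; exists (b * j - a * i).
have -> : a - 5 * b - k = a - 5 * b - k * (a * d - b * c) by rewrite det1 mulr1.
transitivity (b * (k * (5 * a + c) - 5) - a * (k * (5 * b + d) - 1)); first by ring.
by rewrite hi hj; ring.
Qed.

(** Write s = s0 + s1 omega; [divs x y k l] says that 13 divides s (x + y omega) - (k + l omega).
    The four instances are the entries of adj(G) (T - 1), with G = [gramF] and T the matrix of s M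
    on rows in the basis (w_P, w_L). For each of the six units they follow linearly from the three
    congruences. *)
Lemma transv_entries_integral (a b c d s0 s1 : int) : eis_unit s0 s1 ->
  a * d - b * c = 1 ->
  (13%:Z %| (s0 + 3 * s1) * (5 * b + d) - 1)%Z ->
  (13%:Z %| (s0 + 3 * s1) * (5 * a + c) - 5)%Z ->
  let divs x y k l := (13%:Z %| s0 * x - s1 * y - k)%Z /\
    (13%:Z %| s0 * y + s1 * x - s1 * y - l)%Z in
  [/\ divs (3 * a + 2 * b + c + d) (b - c) 4 0,
      divs (- 2 * a - b + 3 * c + d) (- a - b + 3 * c + 2 * d) (-1) 1,
      divs (- a - d) (a - 3 * b + c - 2 * d) (-2) (-1)
    & divs (a - b - 2 * c + 3 * d) (b - c) 4 0].
Proof.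
move=> us det1 h1 h2; have h3 := unit_reduction det1 h1 h2.
rewrite /=; move: h1 h2 h3 {det1}.
by case: us => [] [] [-> ->] h1 h2 h3; (do 4?split); lia.
Qed.

End Extension.

(** * Realizing the matrices of level 13 and computing the image *)

Section Realization.
Variable R : realType.
Local Notation C := (R[i]).
Local Notation E := (eisenstein R).
Local Notation L := (latL R).
Local Notation w := (omega R).

Lemma unit_represents (M : SL2 int) (s0 s1 : int) : eis_unit s0 s1 -> level13 M ->
  (13%:Z %| (s0 + 3 * s1) * (5 * M 0%R 1%R + M 1%R 1%R) - 1)%Z ->
  exists2 g : autL R, stabF g & represents g (SL2_map R M).
Proof.
move=> us lM h1.
have det1 : M 0 0 * M 1 1 - M 0 1 * M 1 0 = 1 by apply: SL2_detE.
(* The other entry of the eigenvector equation, equivalent to the first by the level condition. *)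
have h2 : (13%:Z %| (s0 + 3 * s1) * (5 * M 0%R 0%R + M 1%R 0%R) - 5)%Z.
  have /dvdzP[q hq] := lM; have /dvdzP[r hr] := h1.
  apply/dvdzP; exists ((s0 + 3 * s1) * (q - 2 * M 0 1) + 5 * r).
  transitivity ((s0 + 3 * s1) * (5 * M 0 0 + M 0 1 + M 1 0 - 5 * M 1 1 - 26 * M 0 1)
    + 5 * ((s0 + 3 * s1) * (5 * M 0 1 + M 1 1) - 1)); first by ring.
  by rewrite hq hr; ring.
have := transv_entries_integral us det1 h1 h2.
have nsC : (s0%:~R ^+ 2 - s0%:~R * s1%:~R + s1%:~R ^+ 2 : C) = 1.
  by rewrite -!rmorphXn -!rmorphM -rmorphB -rmorphD /= eis_unit_norm.
pose s : C := s0%:~R + s1%:~R * w.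
have ss : s * conjc s = 1.
  rewrite -nsC /s conjcD conjcM !conjc_int conj_omega; ring: (omega_sqr R).
pose u : E := Eisenstein (eis_conj (eis R s0 s1)) * Eisenstein (eis_conj (eis R s0 s1)).
have us2 : eis_val u = conjc s ^+ 2.
  by rewrite expr2 eis_valM [eis_val (Eisenstein _)](_ : _ = conjc (eis_val (eis R s0 s1))) // eis_valE.
have actsE (T : 'M[C]_2) : (forall x : FC R,
    beta_num (x *m T) = s * ((M 0 0)%:~R * beta_num x + (M 0 1)%:~R * beta_den x)
    /\ beta_den (x *m T) = s * ((M 1 0)%:~R * beta_num x + (M 1 1)%:~R * beta_den x)) ->
    acts_as T s (SL2_map R M).
  by move=> h x; have := h x; rewrite !mxE !real_complex_int.
move: (M 0 0) (M 0 1) (M 1 0) (M 1 1) actsE => a b c d actsE.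
move=> [[/dvdzP[n00 e00] /dvdzP[n00' e00']] [/dvdzP[n01 e01] /dvdzP[n01' e01']]
  [/dvdzP[n10 e10] /dvdzP[n10' e10']] [/dvdzP[n11 e11] /dvdzP[n11' e11']]].
have nE (x y k l n n' : int) : s0 * x - s1 * y - k = n * 13 ->
    s0 * y + s1 * x - s1 * y - l = n' * 13 ->
    eis_val (eis R n n') = (s * (x%:~R + y%:~R * w) - (k%:~R + l%:~R * w)) / 13.
  move=> e e'; apply: (@mulIf _ 13); first by rewrite pnatr_eq0.
  rewrite divfK ?pnatr_eq0 // eis_valE.
  transitivity ((n * 13)%:~R + (n' * 13)%:~R * w); first by rewrite !intrM; ring.
  by rewrite -e -e' /s !(intrD, intrB, intrM, intrN); ring: (omega_sqr R).
have v00 := nE _ _ _ _ _ _ e00 e00'; have v01 := nE _ _ _ _ _ _ e01 e01'.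
have v10 := nE _ _ _ _ _ _ e10 e10'; have v11 := nE _ _ _ _ _ _ e11 e11'.
(* N = adj(G) (T - 1) / 13 solves 1 + G N = T, and the divisibilities put its entries in
   Z[omega]. *)
pose N : 'M[E]_2 := mx2 (eis R n00 n00') (eis R n01 n01') (eis R n10 n10') (eis R n11 n11').
apply: (transv_extends (N := N) ss us2); apply: actsE => x.
have [g00 g01 g10 g11] : [/\ eis_val (gramF R 0 0) = 4, eis_val (gramF R 0 1) = 1 - w,
    eis_val (gramF R 1 0) = 2 + w & eis_val (gramF R 1 1) = 4].
  have [-> -> -> ->] : [/\ gramF R 0 0 = 4, gramF R 0 1 = pbarE R,
    gramF R 1 0 = pE R & gramF R 1 1 = 4] by rewrite !mxE.
  by rewrite pbarE_val conj_p pE_val eis_val_nat.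
have [N00 N01 N10 N11] : [/\ N 0 0 = eis R n00 n00', N 0 1 = eis R n01 n01',
    N 1 0 = eis R n10 n10' & N 1 1 = eis R n11 n11'] by rewrite !mxE.
have tE i j : map_mx (@eis_val R) (1%:M + gramF R *m N) i j = (i == j)%:R
    + (eis_val (gramF R i 0) * eis_val (N 0 j) + eis_val (gramF R i 1) * eis_val (N 1 j)).
  by rewrite mxE [X in eis_val X]mxE eis_valD [X in eis_val X + _]mxE eis_val_nat
    [X in _ + eis_val X]mxE sum_ord2 eis_valD !eis_valM.
have xE (T : 'M[C]_2) j : (x *m T) 0 j = x 0 0 * T 0 j + x 0 1 * T 1 j.
  by rewrite mxE sum_ord2.
rewrite /beta_num /beta_den !xE !tE g00 g01 g10 g11 N00 N01 N10 N11 v00 v01 v10 v11 /=.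
rewrite thetaE /pC !(intrD, intrB, intrM, intrN) /s.
by split; field: (omega_sqr R).
Qed.

(** At omega = 3 the six units reduce to 1, 3, 4, 9, 10 and 12, the nonzero squares modulo 13; each
    case takes the unit that reduces to the inverse of r. *)
Lemma square_represents (M : SL2 int) (q r : int) : level13 M ->
  5 * M 0 1 + M 1 1 = 13 * q + r -> r \in [:: 1; 3; 4; 9; 10; 12] ->
  exists2 g : autL R, stabF g & represents g (SL2_map R M).
Proof.
move=> lM hk; rewrite !inE.
have H s0 s1 : eis_unit s0 s1 -> (13%:Z %| (s0 + 3 * s1) * (13 * q + r) - 1)%Z ->
    exists2 g : autL R, stabF g & represents g (SL2_map R M).
  by move=> us hs; apply: (unit_represents us lM); rewrite hk.
case/or4P=> [/eqP e|/eqP e|/eqP e|/or3P[]/eqP e]; rewrite {r}e in hk H.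
- by apply: (H 1 0); [left; constructor 1 | lia].
- by apply: (H (-1) (-1)); [left; constructor 3 | lia].
- by apply: (H 0 (-1)); [right; constructor 2 | lia].
- by apply: (H 0 1); [left; constructor 2 | lia].
- by apply: (H 1 1); [right; constructor 3 | lia].
- by apply: (H (-1) 0); [right; constructor 1 | lia].
Qed.

(* Units of Z[omega] only reach the squares modulo 13. The polarity acts by a
   non-square, so it exchanges the two classes. *)
Lemma level13_represents (M : SL2 int) : level13 M ->
  exists2 g : autL R, stabF g & represents g (SL2_map R M).
Proof.
move=> lM.
have [q [r [hk r0 r13]]] : exists q r : int,
    [/\ 5 * M 0 1 + M 1 1 = 13 * q + r, 0 <= r & r < 13].
  exists ((5 * M 0%R 1%R + M 1%R 1%R) %/ 13)%Z, ((5 * M 0%R 1%R + M 1%R 1%R) %% 13)%Z.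
  by split; [rewrite {1}(divz_eq (5 * M 0 1 + M 1 1) 13) mulrC | apply: modz_ge0 | apply: ltz_pmod].
have [rsq|] := boolP (r \in [:: 1; 3; 4; 9; 10; 12]).
  exact: square_represents lM hk rsq.
move=> rn.
have det1 : M 0 0 * M 1 1 - M 0 1 * M 1 0 = 1 by apply: SL2_detE.
have detM' : \det (mx2 (M 1 0) (M 1 1) (- M 0 0) (- M 0 1)) == 1.
  by rewrite det_mx2 -det1; apply/eqP; ring.
pose M' : SL2 int := MkSL2 detM'.
have SM' : (MkSL2 det_S * M')%g = M.
  apply/val_inj; rewrite /= [RHS]mx2_eta; apply/matrixP.
  apply: ord2_ind; apply: ord2_ind; rewrite !mxE sum_ord2 !mxE /=; ring.
have lM' : level13 M'.
  by move: lM; rewrite /level13 !mxE /=; lia.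
(* A zero eigenvalue modulo 13 would make 13 divide the determinant 1. *)
have r_neq0 : r != 0.
  apply/eqP => e; have /dvdzP[t ht] := lM.
  have : (13%:Z %| 1)%Z; last by [].
  rewrite -[X in (_ %| X)%Z]det1; apply/dvdzP.
  exists (M 0 0 * q - M 0 1 * (t + 5 * q - 2 * M 0 1)).
  transitivity (M 0 0 * (13 * q + r - 5 * M 0 1)
     - M 0 1 * (t * 13 - 5 * M 0 0 - M 0 1 + 5 * (13 * q + r - 5 * M 0 1))); last first.
    by rewrite e; ring.
  by rewrite -hk -ht; ring.
have [q' [r' [hk' rsq']]] : exists q' r' : int,
    5 * M' 0 1 + M' 1 1 = 13 * q' + r' /\ r' \in [:: 1; 3; 4; 9; 10; 12].
  rewrite !mxE /=; move: rn; rewrite !inE => rn.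
  have rr : r = 2 \/ r = 5 \/ r = 6 \/ r = 7 \/ r = 8 \/ r = 11 by lia.
  (* The eigenvalue of M' = S^-1 M is 5 r modulo 13. As 5 is a non-square, 5 r is a square whenever
     r is not. *)
  have e : 5 * M 1 1 - M 0 1 = 13 * (5 * q - 2 * M 0 1) + 5 * r.
    have -> : M 1 1 = 13 * q + r - 5 * M 0 1 by rewrite -hk; ring.
    by ring.
  case: rr => [|[|[|[|[|]]]]] er; rewrite er in e.
  - by exists (5 * q - 2 * M 0 1), 10; rewrite e.
  - by exists (5 * q - 2 * M 0 1 + 1), 12; rewrite e; split=> //; ring.
  - by exists (5 * q - 2 * M 0 1 + 2), 4; rewrite e; split=> //; ring.
  - by exists (5 * q - 2 * M 0 1 + 2), 9; rewrite e; split=> //; ring.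
  - by exists (5 * q - 2 * M 0 1 + 3), 1; rewrite e; split=> //; ring.
  - by exists (5 * q - 2 * M 0 1 + 4), 3; rewrite e; split=> //; ring.
have [g gF gM'] := square_represents lM' hk' rsq'.
have sF := sig_stabF R perp_polarity; have sS := sig_represents R perp_polarity.
exists (sig R perp_polarity * g)%g; first exact: stabFM.
by rewrite -SM' SL2_mapM; apply: representsM.
Qed.

Lemma cbeta_PSL2Z : cbeta (R := R) @` GammaF R `&` PSL2Z R =
  [set ((nu R)^-1 * m * nu R)%g | m in Gamma0 R 13].
Proof.
have nuE : nu R = PSL2_int R nuZ by [].
apply/seteqP; split=> [_ [[_ [g -> gF] <-] [M _ eM]]|_ [_ [N lN <-] <-]].
  have [M' gM'] := represents_ex gF; have eg := cbetaE gF gM'.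
  (* The integral matrix M has the same class as M', so it represents [g] too. *)
  have gM : represents g (SL2_map R M).
    exact: represents_class gM' (etrans (esym eg) (esym eM)).
  have lM := represents_Gamma0 gF gM.
  exists (PSL2_int R (nuZ * M * nuZ^-1)%g).
    by exists (nuZ * M * nuZ^-1)%g => //; rewrite /mkset dvd_conj_nu.
  by rewrite nuE -eM -PSL2_intV -!PSL2_intM !mulgA mulVg mul1g mulgVK.
rewrite nuE -PSL2_intV -!PSL2_intM.
set M := (nuZ^-1 * N * nuZ)%g.
have lM : level13 M.
  by rewrite -dvd_conj_nu /M !mulgA mulgV mul1g mulgK.
have [g gF gM] := level13_represents lM.
split; last by exists M.
by exists (PAut_class g); [exists g | rewrite (cbetaE gF gM)].
Qed.

Lemma principal_congruence_sub : principal_congruence R 13 `<=` cbeta (R := R) @` GammaF R.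
Proof.
move=> _ [M hM <-].
have lM : level13 M.
  have h i j : (13%:Z %| M i j - (i == j)%:R%R)%Z by rewrite -eqz_mod_dvd; apply/eqP/hM.
  have h00 : (13%:Z %| M 0%R 0%R - 1)%Z := h 0 0.
  have h01 : (13%:Z %| M 0%R 1%R - 0)%Z := h 0 1.
  have h10 : (13%:Z %| M 1%R 0%R - 0)%Z := h 1 0.
  have h11 : (13%:Z %| M 1%R 1%R - 1)%Z := h 1 1.
  rewrite /level13; lia.
have [g gF gM] := level13_represents lM.
by exists (PAut_class g); [exists g | rewrite (cbetaE gF gM)].
Qed.

End Realization.

Unset Implicit Arguments.

Theorem theorem5p1 (R : realType) :
  exists beta : {vspace FC R} -> R[i],
    [/\ set_bij (Pplus R) (upper R) beta,
        forall x y : FC R, 0 < hformC x x -> 0 < hformC y y ->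
          dH (beta <[x]>%VS) (beta <[y]>%VS) = dP x y,
        [/\ beta <[rhobar R]>%VS = 0 +i* 1,
            beta <[wPC R]>%VS = pC R
          & beta <[wLC R]>%VS = - (pC R)^-1]
      & boundary_value beta (z0 R) 0]
    /\
    exists c : PAut R -> PSL2 R,
      [/\ {in GammaF R &, {morph c : h k / (h * k)%g}},
          forall g : autL R, g @` latF R = latF R ->
            forall U : {vspace FC R}, Pplus R U ->
              beta (act_line g U) = psl_act (c (PAut_class g)) (beta U),
          principal_congruence R 13 `<=` c @` GammaF R,
          c @` GammaF R `&` PSL2Z R
            = [set ((nu R)^-1 * m * nu R)%g | m in Gamma0 R 13]
        & forall (lx : ppoint -> pline) (xl : pline -> ppoint),
            is_polarity lx xl ->
            exists s : autL R,
              [/\ forall l : pline, s (vln R l) = vpt R (xl l),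
                  forall x : ppoint, s (vpt R x) = - omegaE R *: vln R (lx x),
                  s @` latF R = latF R
                & c (PAut_class s) = S_PSL2 R]].
Proof.
exists (@beta R); split.
  split; [exact: beta_bij | exact: beta_isometry | | exact: beta_z0].
  by split; [exact: beta_rhobar | exact: beta_wP | exact: beta_wL].
exists (@cbeta R); split.
- exact: cbetaM.
- exact: cbeta_act.
- exact: principal_congruence_sub.
- exact: cbeta_PSL2Z.
- move=> lx xl pol; exists (sig R pol); split.
  + exact: sig_ln.
  + exact: sig_pt.
  + exact: sig_stabF.
  + by rewrite (cbetaE (sig_stabF R pol) (sig_represents R pol)).
Qed.
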